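(* There exist a real $3\times 3$ matrix-valued function $A(x,y,t)$ on $\mathbb{T}^2\times\mathbb{R}^+$, which is uniformly elliptic and uniformly $C^1$ (its entries and their first partial derivatives in $x,y,t$ are continuous and bounded), and a non-zero real function $u$ on $\mathbb{T}^2\times\mathbb{R}^+$ which is uniformly $C^2$ (all partial derivatives of order at most $2$ are continuous and bounded), such that $$\operatorname{div}(A\nabla u)=0 \quad\text{in } \mathbb{T}^2\times\mathbb{R}^+,$$ and $u$ has double exponential decay: there are numerical constants $c,C>0$ such that for all sufficiently large $T$, $$\sup_{\mathbb{T}^2\times\{t\ge T\}}|u(x,y,t)|\le Ce^{-ce^{cT}}.$$
   Context: $\mathbb{T}^2=(\mathbb{R}/2\pi\mathbb{Z})^2$ with periodic coordinates $(x,y)$; $t$ denotes the third (non-periodic) coordinate of the cylinder $\mathbb{T}^2\times\mathbb{R}^+$. Here $\nabla$ and $\operatorname{div}$ are taken in all three variables $(x,y,t)$. Uniform ellipticity means there is $\Lambda\ge1$ with $\Lambda^{-1}|\xi|^2\le \xi^TA\xi\le\Lambda|\xi|^2$ for all $\xi\in\mathbb{R}^3$ and all points. *)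

(* Defs.v *)
From Stdlib Require Import Reals Lra.
From Coquelicot Require Import Coquelicot.
Open Scope R_scope.

(* Points (x, y, t) of R^3; a function on T^2 x R^+ is a function on R^3
   that is 2*PI-periodic in x and y, considered on the open half-space t > 0. *)
Definition pt : Type := (R * R * R)%type.

Definition coord (p : pt) (i : nat) : R :=
  match p with (x, y, t) =>
    match i with 0%nat => x | 1%nat => y | _ => t end end.

Definition upd (p : pt) (i : nat) (s : R) : pt :=
  match p with (x, y, t) =>
    match i with 0%nat => (s, y, t) | 1%nat => (x, s, t) | _ => (x, y, s) end end.

Definition Omega (p : pt) : Prop := 0 < coord p 2.

Definition periodic_xy (f : pt -> R) : Prop :=
  forall x y t, f (x + 2 * PI, y, t) = f (x, y, t) /\ f (x, y + 2 * PI, t) = f (x, y, t).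

Definition partial (i : nat) (f : pt -> R) (p : pt) : R :=
  Derive (fun s => f (upd p i s)) (coord p i).

Definition has_partial (i : nat) (f : pt -> R) : Prop :=
  forall p, Omega p -> ex_derive (fun s => f (upd p i s)) (coord p i).

Definition dist3 (p q : pt) : R :=
  Rmax (Rabs (coord p 0 - coord q 0))
       (Rmax (Rabs (coord p 1 - coord q 1)) (Rabs (coord p 2 - coord q 2))).

Definition cont_on (f : pt -> R) : Prop :=
  forall p, Omega p -> forall eps, 0 < eps -> exists delta, 0 < delta /\
    forall q, Omega q -> dist3 p q < delta -> Rabs (f q - f p) < eps.

Definition bounded_on (f : pt -> R) : Prop :=
  exists M, forall p, Omega p -> Rabs (f p) <= M.

Definition unif_C1 (f : pt -> R) : Prop :=
  cont_on f /\ bounded_on f /\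
  forall i, (i < 3)%nat ->
    has_partial i f /\ cont_on (partial i f) /\ bounded_on (partial i f).

Definition unif_C2 (f : pt -> R) : Prop :=
  unif_C1 f /\ forall i, (i < 3)%nat -> unif_C1 (partial i f).

Definition sum3 (g : nat -> R) : R := g 0%nat + g 1%nat + g 2%nat.

Definition unif_elliptic (A : nat -> nat -> pt -> R) : Prop :=
  exists Lam, 1 <= Lam /\
    forall p, Omega p -> forall xi : nat -> R,
      / Lam * sum3 (fun i => xi i ^ 2)
        <= sum3 (fun i => sum3 (fun j => xi i * A i j p * xi j)) /\
      sum3 (fun i => sum3 (fun j => xi i * A i j p * xi j))
        <= Lam * sum3 (fun i => xi i ^ 2).

Definition div_A_grad (A : nat -> nat -> pt -> R) (u : pt -> R) (p : pt) : R :=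
  sum3 (fun i => partial i (fun q => sum3 (fun j => A i j q * partial j u q)) p).

(* Main.v *)
Require Import Defs.
From Stdlib Require Import Reals Lra Lia ZArith.
From Coquelicot Require Import Coquelicot.
Open Scope R_scope.

(* The matrix A need not be symmetric, so a small defect div F can be absorbed into the coefficients
   by a perturbation B with B grad u = F wherever grad u does not vanish.

   On the strip 4n <= t < 4n + 4 put k = k0 2^n and s = t - 4n.  The solution is
   P(s) cos kx + Q(s) cos 2ky, with x and y exchanged for odd n.  For 0 < s < 1 the second mode is
   switched on while it is exponentially (in k) smaller than the first; for 1 < s < 2 the coefficient
   A_xx is raised so that the first mode decays faster and becomes negligible; for 2 < s < 3 the first
   mode is switched off.  The frequency thus doubles in bounded time, so log |u| is of order -2^(t/4).

   A defect E(s) cos 2ky created by a cutoff while the dominant mode is P cos kx, P' = -k P, is the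
   divergence of a flux in the y direction, realised by the row
   (beta sin kx sin 2ky, gamma cos kx cos 2ky, beta cos kx sin 2ky) of B: since
   sin^2 + cos^2 = 1, the entries with beta = E / (2 k^2 P) produce the required flux against the
   dominant mode, and gamma = beta Q' / (2 k Q) cancels what they produce against Q cos 2ky.
   With Q = h^3 e^{...} the quotient E Q' / Q is polynomial in h and its derivatives, so no division
   by a vanishing cutoff occurs.  All entries of B are O(k^j e^{-k}) in C^1. *)

(** * C^1 functions on the half-space *)

Lemma is_derive_add f g x f' g' l :
  is_derive f x f' -> is_derive g x g' -> l = f' + g' ->
  is_derive (fun s : R => f s + g s : R) x l.
Proof.
intros Hf Hg ->. exact (is_derive_plus f g x f' g' Hf Hg).
Qed.

Lemma is_derive_mul f g x f' g' l :
  is_derive f x f' -> is_derive g x g' -> l = f' * g x + f x * g' ->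
  is_derive (fun s : R => f s * g s : R) x l.
Proof.
intros Hf Hg ->. apply (is_derive_mult f g x f' g' Hf Hg). intros; apply Rmult_comm.
Qed.

Lemma continuous_mul {U : UniformSpace} (f g : U -> R) x :
  continuous f x -> continuous g x -> continuous (fun s => f s * g s) x.
Proof. exact (continuous_mult f g x). Qed.

Lemma continuous_add {U : UniformSpace} (f g : U -> R) x :
  continuous f x -> continuous g x -> continuous (fun s => f s + g s) x.
Proof. exact (continuous_plus f g x). Qed.

Lemma locally_upd (p : pt) (i : nat) (Q : pt -> Prop) :
  locally p Q -> locally (coord p i) (fun s => Q (upd p i s)).
Proof.
intros [eps H]; exists eps; intros s Hs; apply H.
destruct p as [[x y] t]; destruct i as [|[|i]]; simpl in *;
  repeat split; simpl; auto; apply ball_center.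
Qed.

Lemma locally_height (p : pt) lo hi :
  lo < coord p 2 < hi -> locally p (fun q => lo < coord q 2 < hi).
Proof.
destruct p as [[x y] t]; simpl; intros [H1 H2].
assert (He : 0 < Rmin (t - lo) (hi - t)) by (apply Rmin_pos; lra).
exists (mkposreal _ He); intros [[x' y'] t'] [_ H]; simpl in *.
change (Rabs (t' - t) < Rmin (t - lo) (hi - t)) in H.
apply Rabs_def2 in H.
generalize (Rmin_l (t - lo) (hi - t)) (Rmin_r (t - lo) (hi - t)); lra.
Qed.

Lemma partial_ext_loc (i : nat) (f g : pt -> R) (p : pt) :
  locally p (fun q => f q = g q) -> partial i f p = partial i g p.
Proof.
intros H; unfold partial; apply Derive_ext_loc.
now apply (locally_upd p i (fun q => f q = g q)).
Qed.

Lemma partial_is_derive (i : nat) (f : pt -> R) (p : pt) l :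
  is_derive (fun s => f (upd p i s)) (coord p i) l -> partial i f p = l.
Proof. apply is_derive_unique. Qed.

(** A pointwise property with a single bound for value and gradient: it can be proved strip by
    strip, and it gives [unif_C1] once [M] does not depend on [p]. *)
Definition C1_at (f : pt -> R) (M : R) (p : pt) : Prop :=
  continuous f p /\ Rabs (f p) <= M /\
  forall i, (i < 3)%nat ->
    ex_derive (fun s => f (upd p i s)) (coord p i) /\
    continuous (partial i f) p /\ Rabs (partial i f p) <= M.

Lemma C1_at_ext_loc (f g : pt -> R) M (p : pt) :
  locally p (fun q => f q = g q) -> C1_at g M p -> C1_at f M p.
Proof.
intros H [Hc [Hb Hd]].
assert (H' : locally p (fun q => g q = f q)) by (revert H; apply filter_imp; auto).
split; [|split].
- now apply continuous_ext_loc with g.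
- now rewrite (locally_singleton _ _ H).
- intros i Hi; destruct (Hd i Hi) as [H1 [H2 H3]]; split; [|split].
  + apply (ex_derive_ext_loc (fun s => g (upd p i s))); auto.
    now apply (locally_upd p i (fun q => g q = f q)).
  + apply continuous_ext_loc with (partial i g); auto.
    apply locally_locally in H'. revert H'; apply filter_imp.
    intros q Hq; now apply partial_ext_loc.
  + now rewrite (partial_ext_loc i f g p H).
Qed.

(** Both hypotheses are needed on a neighbourhood because continuity of the partial derivative of
    the sum at [p] uses the sum rule at all nearby points. *)
Lemma C1_at_plus f g M N p :
  locally p (C1_at f M) -> locally p (C1_at g N) ->
  C1_at (fun q => f q + g q) (M + N) p.
Proof.
intros Hf Hg.
destruct (locally_singleton _ _ Hf) as [Fc [Fb Fd]].
destruct (locally_singleton _ _ Hg) as [Gc [Gb Gd]].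
assert (E : forall i, (i < 3)%nat ->
  locally p (fun q => partial i f q + partial i g q = partial i (fun q => f q + g q) q)).
{ intros i Hi; generalize (filter_and _ _ Hf Hg); apply filter_imp.
  intros q [[_ [_ H1]] [_ [_ H2]]]; symmetry; apply partial_is_derive.
  apply (is_derive_add (fun s => f (upd q i s)) (fun s => g (upd q i s)) _ (partial i f q) (partial i g q)); auto;
  apply Derive_correct; [apply (H1 i Hi) | apply (H2 i Hi)]. }
split; [|split].
- now apply continuous_add.
- eapply Rle_trans; [apply Rabs_triang|]; lra.
- intros i Hi; destruct (Fd i Hi) as [H1 [H2 H3]]; destruct (Gd i Hi) as [K1 [K2 K3]].
  split; [|split].
  + apply (ex_derive_plus (fun s => f (upd p i s)) (fun s => g (upd p i s))); auto.
  + eapply continuous_ext_loc; [apply (E i Hi)|]. now apply continuous_add.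
  + rewrite <- (locally_singleton _ _ (E i Hi)).
    eapply Rle_trans; [apply Rabs_triang|]; lra.
Qed.

Lemma C1_at_le f M N p : M <= N -> C1_at f M p -> C1_at f N p.
Proof.
intros H [Hc [Hb Hd]]; split; [|split]; auto; [lra|].
intros i Hi; destruct (Hd i Hi) as [H1 [H2 H3]]; repeat split; auto; lra.
Qed.

Lemma C1_at_const c M p : Rabs c <= M -> C1_at (fun _ => c) M p.
Proof.
intros Hc; split; [apply continuous_const|split; [auto|]]; intros i Hi.
assert (E : forall q, partial i (fun _ => c) q = 0) by (intros; unfold partial; apply Derive_const).
split; [apply ex_derive_const|split].
- apply continuous_ext with (fun _ => 0); [intros; now rewrite E|apply continuous_const].
- rewrite E, Rabs_R0; generalize (Rabs_pos c); lra.
Qed.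

Lemma cont_on_continuous f :
  (forall p, Omega p -> continuous f p) -> cont_on f.
Proof.
intros H p Hp eps He.
destruct (proj1 (filterlim_locally f (f p)) (H p Hp) (mkposreal eps He)) as [d Hd].
exists d; split; [apply cond_pos|]; intros q _ Hq.
apply (Hd q); unfold dist3 in Hq.
destruct p as [[x y] t], q as [[x' y'] t']; simpl in Hq.
apply Rmax_Rlt in Hq as [Hx Hq]; apply Rmax_Rlt in Hq as [Hy Ht].
repeat split; simpl;
  [change (Rabs (x' - x) < d)|change (Rabs (y' - y) < d)|change (Rabs (t' - t) < d)];
  now rewrite Rabs_minus_sym.
Qed.

Lemma unif_C1_C1_at f M : (forall p, Omega p -> C1_at f M p) -> unif_C1 f.
Proof.
intros H; split; [|split].
- apply cont_on_continuous; intros p Hp; apply (H p Hp).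
- exists M; intros p Hp; apply (H p Hp).
- intros i Hi; split; [|split].
  + intros p Hp; apply (H p Hp); auto.
  + apply cont_on_continuous; intros p Hp; apply (H p Hp); auto.
  + exists M; intros p Hp; apply (H p Hp); auto.
Qed.

(** * Products g(t) X(x) Y(y) with separated variables *)

Definition sep (g X Y : R -> R) (p : pt) : R :=
  g (snd p) * X (fst (fst p)) * Y (snd (fst p)).

Lemma continuous_sep g X Y p :
  continuous g (coord p 2) -> continuous X (coord p 0) -> continuous Y (coord p 1) ->
  continuous (sep g X Y) p.
Proof.
destruct p as [[x y] t]; simpl; intros Hg HX HY; unfold sep.
apply continuous_mul; [apply continuous_mul|].
- apply (continuous_comp (fun p : pt => snd p) g); [apply continuous_snd | exact Hg].
- apply (continuous_comp (fun p : pt => fst (fst p)) X); [|exact HX].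
  apply (continuous_comp (fun p : pt => fst p) fst); apply continuous_fst.
- apply (continuous_comp (fun p : pt => snd (fst p)) Y); [|exact HY].
  apply (continuous_comp (fun p : pt => fst p) snd); [apply continuous_fst|apply continuous_snd].
Qed.

(** Value and derivative get separate bounds, since a harmonic of frequency w is bounded by 1 but
    its derivative only by w. *)
Definition C1_bound (f f' : R -> R) (m m' x : R) : Prop :=
  is_derive f x (f' x) /\ continuous f' x /\ Rabs (f x) <= m /\ Rabs (f' x) <= m'.

Lemma Rabs_mul_le a b m n : Rabs a <= m -> Rabs b <= n -> Rabs (a * b) <= m * n.
Proof.
intros; rewrite Rabs_mult; apply Rmult_le_compat; auto; apply Rabs_pos.
Qed.

Lemma is_derive_sep g g' X X' Y Y' lo hi m K p i :
  (forall s, lo < s < hi -> C1_bound g g' m m s) ->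
  (forall x, C1_bound X X' 1 K x) -> (forall y, C1_bound Y Y' 1 K y) ->
  lo < coord p 2 < hi ->
  is_derive (fun s => sep g X Y (upd p i s)) (coord p i)
    (match i with 0%nat => sep g X' Y p | 1%nat => sep g X Y' p | _ => sep g' X Y p end).
Proof.
intros Hg HX HY; destruct p as [[x y] t]; unfold sep; simpl; intros Ht.
destruct i as [|[|i]]; simpl.
- eapply is_derive_mul; [eapply is_derive_mul|apply is_derive_const|]; 
    [apply is_derive_const|apply HX|reflexivity|unfold zero; simpl; ring].
- eapply is_derive_mul; [apply is_derive_const|apply HY|unfold zero; simpl; ring].
- eapply is_derive_mul; [eapply is_derive_mul|apply is_derive_const|]; 
    [apply Hg; exact Ht|apply is_derive_const|reflexivity|unfold zero; simpl; ring].
Qed.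

Lemma partial_sep g g' X X' Y Y' lo hi m K p i :
  (forall s, lo < s < hi -> C1_bound g g' m m s) ->
  (forall x, C1_bound X X' 1 K x) -> (forall y, C1_bound Y Y' 1 K y) ->
  lo < coord p 2 < hi ->
  partial i (sep g X Y) p =
    match i with 0%nat => sep g X' Y p | 1%nat => sep g X Y' p | _ => sep g' X Y p end.
Proof. intros; apply partial_is_derive; eapply is_derive_sep; eauto. Qed.

(** Each partial derivative hits one factor only: a derivative of [X] or [Y] costs at most [K], one
    of [g] costs nothing as [m] bounds [g'] too. *)
Lemma C1_at_sep g g' X X' Y Y' lo hi m K p :
  (forall s, lo < s < hi -> C1_bound g g' m m s) ->
  (forall x, C1_bound X X' 1 K x) -> (forall y, C1_bound Y Y' 1 K y) ->
  1 <= K -> lo < coord p 2 < hi -> C1_at (sep g X Y) (m * K) p.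
Proof.
intros Hg HX HY HK Ht.
destruct (Hg _ Ht) as [G1 [G2 [G3 G4]]].
destruct (HX (coord p 0)) as [X1 [X2 [X3 X4]]].
destruct (HY (coord p 1)) as [Y1 [Y2 [Y3 Y4]]].
assert (Gc : continuous g (coord p 2)) by (apply (ex_derive_continuous (V := R_NormedModule)); eexists; apply G1).
assert (Xc : continuous X (coord p 0)) by (apply (ex_derive_continuous (V := R_NormedModule)); eexists; apply X1).
assert (Yc : continuous Y (coord p 1)) by (apply (ex_derive_continuous (V := R_NormedModule)); eexists; apply Y1).
assert (Hm : 0 <= m) by (eapply Rle_trans; [apply Rabs_pos|apply G3]).
assert (HmK : m <= m * K) by nra.
split; [|split].
- now apply continuous_sep.
- destruct p as [[x y] t]; unfold sep; simpl in *.
  apply Rle_trans with (m * 1 * 1); [|lra]. repeat apply Rabs_mul_le; auto.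
- intros i Hi; split; [|split].
  + eexists; eapply is_derive_sep; eauto.
  + apply continuous_ext_loc with
      (fun p => match i with 0%nat => sep g X' Y p | 1%nat => sep g X Y' p | _ => sep g' X Y p end).
    * generalize (locally_height p lo hi Ht); apply filter_imp.
      intros q Hq; symmetry; eapply partial_sep; eauto.
    * destruct i as [|[|i]]; now apply continuous_sep.
  + rewrite (partial_sep g g' X X' Y Y' lo hi m K); auto.
    destruct p as [[x y] t]; unfold sep; simpl in *.
    destruct i as [|[|i]].
    * replace (m * K) with (m * K * 1) by ring; repeat apply Rabs_mul_le; auto.
    * replace (m * K) with (m * 1 * K) by ring; repeat apply Rabs_mul_le; auto.
    * apply Rle_trans with (m * 1 * 1); [|lra]. repeat apply Rabs_mul_le; auto.
Qed.

(** * A C^3 step function *)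

Definition pos_part (x : R) : R := Rmax 0 x.

Lemma pos_part_ge0 x : 0 <= pos_part x.
Proof. apply Rmax_l. Qed.

Lemma pos_part_neg x : x <= 0 -> pos_part x = 0.
Proof. apply Rmax_left. Qed.

Lemma pos_part_id x : 0 <= x -> pos_part x = x.
Proof. apply Rmax_right. Qed.

Lemma continuous_pos_part x : continuous pos_part x.
Proof.
apply continuous_ext with (fun x => (x + Rabs x) * / 2).
- intros y; unfold pos_part, Rmax, Rabs; destruct Rle_dec, Rcase_abs; lra.
- apply continuous_mul; [apply continuous_add|apply continuous_const].
  + apply continuous_id.
  + apply continuous_Rabs.
Qed.

(** Only the origin is delicate: there the difference quotient is 0 on the left and h^(n+1) on the
    right, which tends to 0. *)
Lemma is_derive_pos_part_pow (n : nat) x :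
  is_derive (fun s => pos_part s ^ S (S n)) x (INR (S (S n)) * pos_part x ^ S n).
Proof.
destruct (Rtotal_order x 0) as [Hx|[->|Hx]].
- apply is_derive_ext_loc with (fun _ => 0).
  + assert (H : locally x (fun y => y < 0)) by now apply open_lt.
    revert H; apply filter_imp; intros y Hy.
    rewrite pos_part_neg; [simpl; ring|lra].
  + rewrite pos_part_neg by lra.
    replace (INR (S (S n)) * 0 ^ S n) with 0 by (simpl pow; ring).
    apply (is_derive_const (0 : R) x).
- rewrite pos_part_neg by lra.
  replace (INR (S (S n)) * 0 ^ S n) with 0 by (simpl pow; ring).
  apply is_derive_Reals; intros eps Heps.
  (* The bound 1 gives h^n <= 1, and then h * h^n <= h < eps. *)
  exists (mkposreal (Rmin eps 1) (Rmin_pos _ _ Heps Rlt_0_1)); simpl; intros h Hh0 Hh.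
  assert (H1 := Rmin_l eps 1); assert (H2 := Rmin_r eps 1).
  rewrite (pos_part_neg 0) by lra; rewrite Rplus_0_l.
  destruct (Rle_dec h 0) as [Hn|Hp].
  + rewrite pos_part_neg by lra.
    match goal with |- Rabs ?a < _ => replace a with 0 by (field; auto) end.
    now rewrite Rabs_R0.
  + rewrite pos_part_id by lra.
    match goal with |- Rabs ?a < _ => replace a with (h * h ^ n) by (field; auto) end.
    rewrite Rabs_pos_eq in Hh by lra.
    assert (0 <= h ^ n) by (apply pow_le; lra).
    assert (h ^ n <= 1) by (rewrite <- (pow1 n); apply pow_incr; lra).
    rewrite Rabs_pos_eq; nra.
- apply is_derive_ext_loc with (fun s => s ^ S (S n)).
  + assert (H : locally x (fun y => 0 < y)) by now apply open_gt.
    revert H; apply filter_imp; intros y Hy.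
    rewrite pos_part_id; [reflexivity|lra].
  + rewrite pos_part_id by lra.
    auto_derive; [trivial|]. simpl. ring.
Qed.

(** The step is 1 - ((1 - s_+^4)_+)^4; the two fourth powers make it C^3 at 0 and at 1. Three
    derivatives are required because the coefficients of the matrix contain the second derivative
    and must be C^1. *)
Definition co_step (s : R) : R := pos_part (1 - pos_part s ^ 4).

Definition step (s : R) : R := 1 - co_step s ^ 4.
Definition step1 (s : R) : R := 16 * (pos_part s ^ 3 * co_step s ^ 3).
Definition step2 (s : R) : R :=
  48 * (pos_part s ^ 2 * co_step s ^ 3) - 192 * (pos_part s ^ 6 * co_step s ^ 2).
Definition step3 (s : R) : R :=
  96 * (pos_part s * co_step s ^ 3) - 1728 * (pos_part s ^ 5 * co_step s ^ 2)
  + 1536 * (pos_part s ^ 9 * co_step s).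

Lemma co_step_left s : s <= 0 -> co_step s = 1.
Proof.
intros Hs; unfold co_step; rewrite (pos_part_neg s) by lra.
rewrite pos_part_id; simpl; lra.
Qed.

Lemma co_step_right s : 1 <= s -> co_step s = 0.
Proof.
intros Hs; unfold co_step; apply pos_part_neg; rewrite pos_part_id by lra.
generalize (pow_R1_Rle s 4 Hs); lra.
Qed.

Lemma co_step_bounds s : 0 <= co_step s <= 1.
Proof.
split; [apply pos_part_ge0|]; unfold co_step.
apply Rmax_lub; [lra|]. generalize (pow_le _ 4 (pos_part_ge0 s)); lra.
Qed.

Lemma step_left s : s <= 0 -> step s = 0.
Proof. intros; unfold step; rewrite co_step_left by auto; ring. Qed.
Lemma step_right s : 1 <= s -> step s = 1.
Proof. intros; unfold step; rewrite co_step_right by auto; ring. Qed.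
Lemma step1_left s : s <= 0 -> step1 s = 0.
Proof. intros; unfold step1; rewrite pos_part_neg by auto; ring. Qed.
Lemma step1_right s : 1 <= s -> step1 s = 0.
Proof. intros; unfold step1; rewrite co_step_right by auto; ring. Qed.
Lemma step2_left s : s <= 0 -> step2 s = 0.
Proof. intros; unfold step2; rewrite pos_part_neg by auto; ring. Qed.
Lemma step2_right s : 1 <= s -> step2 s = 0.
Proof. intros; unfold step2; rewrite co_step_right by auto; ring. Qed.

Lemma step_bounds s : 0 <= step s <= 1.
Proof.
unfold step; assert (H := co_step_bounds s).
assert (0 <= co_step s ^ 4) by (apply pow_le; lra).
assert (co_step s ^ 4 <= 1) by (rewrite <- (pow1 4); apply pow_incr; lra). lra.
Qed.

Lemma step1_ge0 s : 0 <= step1 s.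
Proof.
unfold step1; apply Rmult_le_pos; [lra|]; apply Rmult_le_pos; apply pow_le.
- apply pos_part_ge0.
- apply co_step_bounds.
Qed.

Lemma is_derive_co_step_pow (n : nat) s :
  is_derive (fun s => co_step s ^ S (S n)) s
    (- (4 * INR (S (S n))) * (pos_part s ^ 3 * co_step s ^ S n)).
Proof.
unfold co_step.
assert (H1 : is_derive (fun s => 1 - pos_part s ^ 4) s (- (4 * pos_part s ^ 3))).
{ apply is_derive_ext with (fun s => 1 + (-1) * pos_part s ^ 4); [intros; simpl; ring|].
  eapply is_derive_add; [apply is_derive_const| |].
  - eapply is_derive_mul; [apply is_derive_const|apply is_derive_pos_part_pow|reflexivity].
  - unfold zero; simpl; ring. }
assert (H2 := is_derive_comp (fun x => pos_part x ^ S (S n)) _ s _ _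
  (is_derive_pos_part_pow n _) H1).
simpl in H2 |- *.
match goal with |- is_derive _ _ ?l => match type of H2 with is_derive _ _ ?l' =>
  replace l with l'; [exact H2|] end end.
unfold scal; simpl; unfold mult; simpl; ring.
Qed.

Lemma is_derive_cmul c f x f' l :
  is_derive f x f' -> l = c * f' -> is_derive (fun s : R => c * f s : R) x l.
Proof.
intros Hf ->; apply (is_derive_scal f x c f' Hf).
Qed.

Lemma is_derive_step_term (m n : nat) s :
  is_derive (fun s => pos_part s ^ S (S m) * co_step s ^ S (S n)) s
    (INR (S (S m)) * (pos_part s ^ S m * co_step s ^ S (S n))
     - 4 * INR (S (S n)) * (pos_part s ^ (m + 5) * co_step s ^ S n)).
Proof.
eapply is_derive_mul; [apply is_derive_pos_part_pow|apply is_derive_co_step_pow|].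
rewrite pow_add; simpl pow; ring.
Qed.

Lemma is_derive_step s : is_derive step s (step1 s).
Proof.
apply is_derive_ext with (fun s => 1 + (-1) * co_step s ^ 4).
{ intros; unfold step; simpl; ring. }
eapply is_derive_add; [apply is_derive_const| |].
- eapply is_derive_cmul; [apply is_derive_co_step_pow|reflexivity].
- unfold step1, zero; simpl; ring.
Qed.

Lemma is_derive_step1 s : is_derive step1 s (step2 s).
Proof.
eapply is_derive_cmul; [apply is_derive_step_term|].
unfold step2; simpl; ring.
Qed.

Lemma is_derive_step2 s : is_derive step2 s (step3 s).
Proof.
apply is_derive_ext with (fun s =>
  48 * (pos_part s ^ 2 * co_step s ^ 3) + (-192) * (pos_part s ^ 6 * co_step s ^ 2)).
{ intros; unfold step2; simpl; ring. }
eapply is_derive_add;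
  [eapply is_derive_cmul; [apply is_derive_step_term|reflexivity]
  |eapply is_derive_cmul; [apply is_derive_step_term|reflexivity]|].
unfold step3; simpl; ring.
Qed.

Lemma continuous_pow_R (f : R -> R) n s : continuous f s -> continuous (fun s => f s ^ n) s.
Proof.
intros H; induction n; simpl; [apply continuous_const|]. now apply continuous_mul.
Qed.

Lemma continuous_co_step s : continuous co_step s.
Proof.
apply (continuous_comp (fun s => 1 - pos_part s ^ 4) pos_part); [|apply continuous_pos_part].
apply (continuous_minus (fun _ => 1) (fun s => pos_part s ^ 4)).
- apply continuous_const.
- apply continuous_pow_R, continuous_pos_part.
Qed.

Lemma continuous_step3 s : continuous step3 s.
Proof.
apply continuous_ext with (fun s => 96 * (pos_part s * co_step s ^ 3)
  + (-1728) * (pos_part s ^ 5 * co_step s ^ 2) + 1536 * (pos_part s ^ 9 * co_step s)).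
{ intros; unfold step3; simpl; ring. }
assert (Hp := continuous_pos_part s); assert (Hq := continuous_co_step s).
apply continuous_add; [apply continuous_add|];
  (apply continuous_mul; [apply continuous_const|apply continuous_mul]);
  auto using continuous_pow_R.
Qed.

(** For s >= 1 the second factor vanishes, its exponent being positive; for s < 1 both factors lie
    in [0,1]. *)
Lemma step_terms_le m n s :
  0 <= pos_part s ^ m * co_step s ^ S n <= 1.
Proof.
assert (H := co_step_bounds s); assert (Hp := pos_part_ge0 s).
assert (0 <= pos_part s ^ m) by now apply pow_le.
assert (0 <= co_step s ^ S n) by (apply pow_le; lra).
split; [nra|].
destruct (Rle_dec 1 s) as [Hs|Hs].
- rewrite co_step_right by lra; simpl; lra.
- assert (pos_part s <= 1) by (apply Rmax_lub; lra).
  assert (pos_part s ^ m <= 1) by (rewrite <- (pow1 m); apply pow_incr; lra).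
  assert (co_step s ^ S n <= 1) by (rewrite <- (pow1 (S n)); apply pow_incr; lra).
  nra.
Qed.

(** One coarse constant serves all three derivatives: the coefficients of [step3] have absolute
    values summing to 3360. *)
Lemma step1_le s : Rabs (step1 s) <= 4000.
Proof. unfold step1; apply Rabs_le; generalize (step_terms_le 3 2 s); lra. Qed.

Lemma step2_le s : Rabs (step2 s) <= 4000.
Proof.
unfold step2; apply Rabs_le; generalize (step_terms_le 2 2 s) (step_terms_le 6 1 s); lra.
Qed.

Lemma step3_le s : Rabs (step3 s) <= 4000.
Proof.
unfold step3; apply Rabs_le.
generalize (step_terms_le 1 2 s) (step_terms_le 5 1 s) (step_terms_le 9 0 s).
rewrite !pow_1; lra.
Qed.

(** * Exponentially small amplitudes *)

(** [C] is uniform in the frequency k, and k^j leaves room for the powers of k that differentiation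
    produces. The range of s exceeds the strip [0,4) by one unit below, so that it contains a
    neighbourhood of the junction s = 0. *)
Definition C1_decay (w : R) (j : nat) (f f' : R -> R -> R) : Prop :=
  exists C, 0 <= C /\ forall k s, 1 <= k -> -1 < s < 4 ->
    C1_bound (f k) (f' k) (C * k ^ j * exp (- (w * k))) (C * k ^ j * exp (- (w * k))) s.

Definition C1_decay_poly (w : R) (f f' : R -> R -> R) : Prop :=
  exists j, C1_decay w j f f'.

Lemma pow_ge1 k j : 1 <= k -> 1 <= k ^ j.
Proof. intros; now apply pow_R1_Rle. Qed.

Lemma C1_bound_le f f' m m' n n' x :
  m <= n -> m' <= n' -> C1_bound f f' m m' x -> C1_bound f f' n n' x.
Proof. intros ? ? [H1 [H2 [H3 H4]]]; split; [|split; [|split]]; auto; lra. Qed.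

Lemma C1_bound_ext f f' g g' m m' x :
  (forall s, f s = g s) -> (forall s, f' s = g' s) ->
  C1_bound f f' m m' x -> C1_bound g g' m m' x.
Proof.
intros Ef Eg [H1 [H2 [H3 H4]]]; rewrite Ef in H3; rewrite Eg in H1, H4.
split; [|split; [|split]]; auto; [now apply is_derive_ext with f|now apply continuous_ext with f'].
Qed.

Lemma C1_decay_ext w j f f' g g' :
  (forall k s, 1 <= k -> f k s = g k s) -> (forall k s, 1 <= k -> f' k s = g' k s) ->
  C1_decay w j f f' -> C1_decay w j g g'.
Proof.
intros Ef Eg [C [HC H]]; exists C; split; auto; intros k s Hk Hs.
apply C1_bound_ext with (f k) (f' k); auto.
Qed.

Lemma C1_decay_poly_ext w f f' g g' :
  (forall k s, 1 <= k -> f k s = g k s) -> (forall k s, 1 <= k -> f' k s = g' k s) ->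
  C1_decay_poly w f f' -> C1_decay_poly w g g'.
Proof. intros Ef Eg [j H]; exists j; now apply C1_decay_ext with f f'. Qed.

Lemma C1_decay_weaken w v i j f f' :
  v <= w -> (i <= j)%nat -> C1_decay w i f f' -> C1_decay v j f f'.
Proof.
intros Hv Hj [C [HC H]]; exists C; split; auto; intros k s Hk Hs.
assert (C * k ^ i * exp (- (w * k)) <= C * k ^ j * exp (- (v * k))).
{ assert (1 <= k ^ i) by now apply pow_ge1.
  assert (k ^ i <= k ^ j) by now apply Rle_pow.
  apply Rmult_le_compat; [nra|apply Rlt_le, exp_pos|nra|].
  destruct (Req_dec v w) as [->|]; [lra|]. apply Rlt_le, exp_increasing; nra. }
eapply C1_bound_le; [| |apply H]; auto.
Qed.

Lemma C1_bound_mul f f' g g' m n x :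
  C1_bound f f' m m x -> C1_bound g g' n n x ->
  C1_bound (fun s => f s * g s) (fun s => f' s * g s + f s * g' s)
    (2 * (m * n)) (2 * (m * n)) x.
Proof.
intros [F1 [F2 [F3 F4]]] [G1 [G2 [G3 G4]]].
assert (Fc : continuous f x) by (apply (ex_derive_continuous (V := R_NormedModule)); eexists; apply F1).
assert (Gc : continuous g x) by (apply (ex_derive_continuous (V := R_NormedModule)); eexists; apply G1).
assert (0 <= m) by (eapply Rle_trans; [apply Rabs_pos|apply F3]).
assert (0 <= n) by (eapply Rle_trans; [apply Rabs_pos|apply G3]).
split; [|split; [|split]].
- eapply is_derive_mul; eauto.
- apply continuous_add; now apply continuous_mul.
- apply Rle_trans with (m * n); [now apply Rabs_mul_le|nra].
- eapply Rle_trans; [apply Rabs_triang|].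
  replace (2 * (m * n)) with (m * n + m * n) by ring.
  apply Rplus_le_compat; now apply Rabs_mul_le.
Qed.

Lemma C1_bound_add f f' g g' m n x :
  C1_bound f f' m m x -> C1_bound g g' n n x ->
  C1_bound (fun s => f s + g s) (fun s => f' s + g' s) (m + n) (m + n) x.
Proof.
intros [F1 [F2 [F3 F4]]] [G1 [G2 [G3 G4]]].
split; [|split; [|split]].
- eapply is_derive_add; eauto.
- now apply continuous_add.
- eapply Rle_trans; [apply Rabs_triang|lra].
- eapply Rle_trans; [apply Rabs_triang|lra].
Qed.

Lemma C1_decay_mul w i j f f' g g' :
  C1_decay w i f f' -> C1_decay 0 j g g' ->
  C1_decay w (i + j) (fun k s => f k s * g k s)
    (fun k s => f' k s * g k s + f k s * g' k s).
Proof.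
intros [C [HC F]] [D [HD G]]; exists (2 * (C * D)); split; [nra|].
intros k s Hk Hs.
replace (2 * (C * D) * k ^ (i + j) * exp (- (w * k))) with
  (2 * ((C * k ^ i * exp (- (w * k))) * (D * k ^ j * exp (- (0 * k))))).
- apply (C1_bound_mul (f k) (f' k) (g k) (g' k)); auto.
- rewrite Rmult_0_l, Ropp_0, exp_0, pow_add; ring.
Qed.

Lemma C1_decay_add w j f f' g g' :
  C1_decay w j f f' -> C1_decay w j g g' ->
  C1_decay w j (fun k s => f k s + g k s) (fun k s => f' k s + g' k s).
Proof.
intros [C [HC F]] [D [HD G]]; exists (C + D); split; [lra|].
intros k s Hk Hs.
replace ((C + D) * k ^ j * exp (- (w * k))) with
  (C * k ^ j * exp (- (w * k)) + D * k ^ j * exp (- (w * k))) by ring.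
apply (C1_bound_add (f k) (f' k) (g k) (g' k)); auto.
Qed.

Lemma C1_decay_coef j (c : R -> R) :
  (exists C, 0 <= C /\ forall k, 1 <= k -> Rabs (c k) <= C * k ^ j) ->
  C1_decay 0 j (fun k _ => c k) (fun _ _ => 0).
Proof.
intros [C [HC H]]; exists C; split; auto; intros k s Hk Hs.
rewrite Rmult_0_l, Ropp_0, exp_0, Rmult_1_r.
split; [|split; [|split]]; [apply (is_derive_const (c k))|apply continuous_const|auto|].
rewrite Rabs_R0; generalize (pow_ge1 k j Hk); nra.
Qed.

Lemma C1_decay_profile f f' c :
  (forall s, is_derive f s (f' s)) -> (forall s, continuous f' s) ->
  (forall s, Rabs (f s) <= 4000) -> (forall s, Rabs (f' s) <= 4000) ->
  C1_decay 0 0 (fun _ s => f (s - c)) (fun _ s => f' (s - c)).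
Proof.
intros H1 H2 H3 H4; exists 4000; split; [lra|]; intros k s _ _.
rewrite Rmult_0_l, Ropp_0, exp_0, !Rmult_1_r.
assert (D : is_derive (fun s => s - c) s 1) by (auto_derive; [trivial|ring]).
split; [|split; [|split]]; auto.
- replace (f' (s - c)) with (1 * f' (s - c)) by ring.
  apply (is_derive_comp f (fun s => s - c)); auto.
- apply (continuous_comp (fun s => s - c) f'); auto.
  apply (ex_derive_continuous (V := R_NormedModule)); eexists; apply D.
Qed.

Lemma C1_decay_poly_mul w f f' g g' :
  C1_decay_poly w f f' -> C1_decay_poly 0 g g' ->
  C1_decay_poly w (fun k s => f k s * g k s) (fun k s => f' k s * g k s + f k s * g' k s).
Proof. intros [i F] [j G]; exists (i + j)%nat; now apply C1_decay_mul. Qed.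

Lemma C1_decay_poly_add w f f' g g' :
  C1_decay_poly w f f' -> C1_decay_poly w g g' ->
  C1_decay_poly w (fun k s => f k s + g k s) (fun k s => f' k s + g' k s).
Proof.
intros [i F] [j G]; exists (i + j)%nat; apply C1_decay_add;
  [apply C1_decay_weaken with w i|apply C1_decay_weaken with w j]; auto; try lra; lia.
Qed.

Lemma C1_decay_poly_const w f f' c :
  C1_decay_poly w f f' -> C1_decay_poly w (fun k s => c * f k s) (fun k s => c * f' k s).
Proof.
intros H; apply C1_decay_poly_ext with
  (fun k s => f k s * c) (fun k s => f' k s * c + f k s * 0).
- intros; ring.
- intros; ring.
- apply (C1_decay_poly_mul w f f' (fun _ _ => c) (fun _ _ => 0)); auto.
  exists 0%nat; apply C1_decay_coef; exists (Rabs c); split; [apply Rabs_pos|].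
  intros; simpl; lra.
Qed.

Lemma C1_decay_poly_sub w f f' g g' :
  C1_decay_poly w f f' -> C1_decay_poly w g g' ->
  C1_decay_poly w (fun k s => f k s - g k s) (fun k s => f' k s - g' k s).
Proof.
intros F G; apply C1_decay_poly_ext with
  (fun k s => f k s + (-1) * g k s) (fun k s => f' k s + (-1) * g' k s).
- intros; ring.
- intros; ring.
- apply (C1_decay_poly_add w f f' (fun k s => (-1) * g k s) (fun k s => (-1) * g' k s)); auto.
  now apply C1_decay_poly_const.
Qed.

Lemma C1_decay_poly_freq c : C1_decay_poly 0 (fun k _ => c * k) (fun _ _ => 0).
Proof.
exists 1%nat; apply C1_decay_coef; exists (Rabs c); split; [apply Rabs_pos|].
intros; rewrite Rabs_mult, (Rabs_pos_eq k) by lra; simpl; lra.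
Qed.

Lemma C1_decay_poly_inv c n : 0 < c -> C1_decay_poly 0 (fun k _ => / (c * k ^ n)) (fun _ _ => 0).
Proof.
intros Hc; exists 0%nat; apply C1_decay_coef; exists (/ c).
split; [apply Rlt_le, Rinv_0_lt_compat; lra|]; intros k Hk.
assert (H := pow_ge1 k n Hk).
rewrite Rabs_pos_eq; [|apply Rlt_le, Rinv_0_lt_compat; nra].
simpl; rewrite Rmult_1_r; apply Rinv_le_contravar; nra.
Qed.

Lemma C1_decay_poly_exp w psi theta theta' :
  (forall k s, 1 <= k -> -1 < s < 4 -> is_derive (psi k) s (theta k s) /\ w * k <= psi k s) ->
  C1_decay_poly 0 theta theta' ->
  C1_decay_poly w (fun k s => exp (- psi k s)) (fun k s => - theta k s * exp (- psi k s)).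
Proof.
(* The part [C] covers the factor [theta] in the derivative, the added 1 covers the exponential
   itself. *)
intros Hpsi [j [C [HC H]]]; exists j, (C + 1); split; [lra|]; intros k s Hk Hs.
destruct (Hpsi k s Hk Hs) as [Hd Hw]; destruct (H k s Hk Hs) as [T1 [T2 [T3 T4]]].
rewrite Rmult_0_l, Ropp_0, exp_0, Rmult_1_r in T3.
assert (Hj := pow_ge1 k j Hk).
assert (D : is_derive (fun s => exp (- psi k s)) s (- theta k s * exp (- psi k s))).
{ apply (is_derive_comp exp (fun s => - psi k s)); [apply is_derive_exp|].
  now apply (is_derive_opp (psi k)). }
assert (E : 0 <= exp (- psi k s) <= exp (- (w * k))).
{ split; [apply Rlt_le, exp_pos|].
  destruct (Req_dec (psi k s) (w * k)) as [->|]; [lra|]. apply Rlt_le, exp_increasing; lra. }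
split; [|split; [|split]]; auto.
- apply continuous_mul.
  + apply (continuous_opp (theta k)).
    apply (ex_derive_continuous (V := R_NormedModule)); eexists; apply T1.
  + apply (ex_derive_continuous (V := R_NormedModule)); eexists; apply D.
- rewrite Rabs_pos_eq by lra. assert (1 <= (C + 1) * k ^ j) by nra. nra.
- apply Rabs_mul_le; [rewrite Rabs_Ropp; nra|rewrite Rabs_pos_eq; lra].
Qed.

(* Amplitude h^3 e of a mode with cutoff h, where e' = - th e, and its derivatives. *)
Definition damp (h e : R) : R := h * h * h * e.
Definition damp1 (h h1 th e : R) : R := (3 * (h * h * h1) - th * (h * h * h)) * e.
Definition damp2 (h h1 h2 th th1 e : R) : R :=
  (6 * (h * h1 * h1) + 3 * (h * h * h2) - 6 * (th * (h * h * h1))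
   + (th * th - th1) * (h * h * h)) * e.

Lemma C1_decay_poly_damp w h h1 th th1 e :
  C1_decay_poly 0 h h1 -> C1_decay_poly 0 th th1 ->
  C1_decay_poly w e (fun k s => - th k s * e k s) ->
  C1_decay_poly w (fun k s => damp (h k s) (e k s))
    (fun k s => damp1 (h k s) (h1 k s) (th k s) (e k s)).
Proof.
intros H H1 He.
eapply C1_decay_poly_ext.
3: eapply C1_decay_poly_mul; [exact He|eapply C1_decay_poly_mul; [eapply C1_decay_poly_mul|]; exact H].
- intros; unfold damp; ring.
- intros; unfold damp1; ring.
Qed.

Lemma C1_decay_poly_damp1 w h h1 h2 th th1 e :
  C1_decay_poly 0 h h1 -> C1_decay_poly 0 h1 h2 -> C1_decay_poly 0 th th1 ->
  C1_decay_poly w e (fun k s => - th k s * e k s) ->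
  C1_decay_poly w (fun k s => damp1 (h k s) (h1 k s) (th k s) (e k s))
    (fun k s => damp2 (h k s) (h1 k s) (h2 k s) (th k s) (th1 k s) (e k s)).
Proof.
intros H H1 Ht He.
eapply C1_decay_poly_ext.
3: eapply C1_decay_poly_mul; [exact He|eapply C1_decay_poly_sub;
  [apply C1_decay_poly_const with (c := 3);
   eapply C1_decay_poly_mul; [eapply C1_decay_poly_mul; exact H|exact H1]
  |eapply C1_decay_poly_mul; [exact Ht|
   eapply C1_decay_poly_mul; [eapply C1_decay_poly_mul|]; exact H]]].
- intros; unfold damp1; ring.
- intros; unfold damp2; ring.
Qed.

(* With q = h^3 e^{-lam s}, q'' - lam^2 q = beta_num e^{-lam s} and gamma_num = beta_num q' / q. *)
Definition beta_num (h h1 h2 lam : R) : R :=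
  6 * (h * h1 * h1) + 3 * (h * h * h2) - 6 * (lam * (h * h * h1)).
Definition gamma_num (h h1 h2 lam : R) : R :=
  18 * (h1 * h1 * h1) + 9 * (h * h1 * h2) - 18 * (lam * (h * h1 * h1))
  - lam * beta_num h h1 h2 lam.

Lemma C1_decay_poly_beta_num h h1 h2 h3 c :
  C1_decay_poly 0 h h1 -> C1_decay_poly 0 h1 h2 -> C1_decay_poly 0 h2 h3 ->
  exists f', C1_decay_poly 0
    (fun k s => beta_num (h k s) (h1 k s) (h2 k s) (c * k)) f'.
Proof.
intros H0 H1 H2; eexists; unfold beta_num.
eapply C1_decay_poly_sub; [eapply C1_decay_poly_add|].
- apply C1_decay_poly_const.
  eapply C1_decay_poly_mul; [eapply C1_decay_poly_mul; [exact H0|exact H1]|exact H1].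
- apply C1_decay_poly_const.
  eapply C1_decay_poly_mul; [eapply C1_decay_poly_mul; exact H0|exact H2].
- apply C1_decay_poly_const.
  eapply C1_decay_poly_mul; [apply C1_decay_poly_freq|].
  eapply C1_decay_poly_mul; [eapply C1_decay_poly_mul; exact H0|exact H1].
Qed.

Lemma C1_decay_poly_gamma_num h h1 h2 h3 c :
  C1_decay_poly 0 h h1 -> C1_decay_poly 0 h1 h2 -> C1_decay_poly 0 h2 h3 ->
  exists f', C1_decay_poly 0
    (fun k s => gamma_num (h k s) (h1 k s) (h2 k s) (c * k)) f'.
Proof.
intros H0 H1 H2; destruct (C1_decay_poly_beta_num _ _ _ _ c H0 H1 H2) as [b Hb].
eexists; unfold gamma_num.
eapply C1_decay_poly_sub; [eapply C1_decay_poly_sub; [eapply C1_decay_poly_add|]|].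
- apply C1_decay_poly_const.
  eapply C1_decay_poly_mul; [eapply C1_decay_poly_mul; exact H1|exact H1].
- apply C1_decay_poly_const.
  eapply C1_decay_poly_mul; [eapply C1_decay_poly_mul; [exact H0|exact H1]|exact H2].
- apply C1_decay_poly_const.
  eapply C1_decay_poly_mul; [apply C1_decay_poly_freq|].
  eapply C1_decay_poly_mul; [eapply C1_decay_poly_mul; [exact H0|exact H1]|exact H1].
- eapply C1_decay_poly_mul; [apply C1_decay_poly_freq|exact Hb].
Qed.

(** * The solution on one strip *)

Definition C1_field (w : R) (F : R -> pt -> R) : Prop :=
  exists j C, 0 <= C /\ forall k p, 1 <= k -> -1 < coord p 2 < 4 ->
    C1_at (F k) (C * k ^ j * exp (- (w * k))) p.

Definition harmonic (X X' : R -> R -> R) : Prop :=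
  forall k x, 1 <= k -> C1_bound (X k) (X' k) 1 (2 * k) x.

Lemma C1_field_sep w g g' X X' Y Y' :
  C1_decay_poly w g g' -> harmonic X X' -> harmonic Y Y' ->
  C1_field w (fun k => sep (g k) (X k) (Y k)).
Proof.
intros [j [C [HC Hg]]] HX HY; exists (j + 1)%nat, (2 * C); split; [lra|].
intros k p Hk Hp.
replace (2 * C * k ^ (j + 1) * exp (- (w * k)))
  with (C * k ^ j * exp (- (w * k)) * (2 * k)) by (rewrite pow_add; ring).
apply (C1_at_sep (g k) (g' k) (X k) (X' k) (Y k) (Y' k) (-1) 4); auto; lra.
Qed.

Lemma C1_field_plus w F G :
  C1_field w F -> C1_field w G -> C1_field w (fun k p => F k p + G k p).
Proof.
intros [i [C [HC HF]]] [j [D [HD HG]]]; exists (i + j)%nat, (C + D); split; [lra|].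
intros k p Hk Hp.
apply C1_at_le with (C * k ^ i * exp (- (w * k)) + D * k ^ j * exp (- (w * k))).
- assert (k ^ i <= k ^ (i + j)) by (apply Rle_pow; [lra|lia]).
  assert (k ^ j <= k ^ (i + j)) by (apply Rle_pow; [lra|lia]).
  assert (0 < exp (- (w * k))) by apply exp_pos.
  rewrite <- Rmult_plus_distr_r; apply Rmult_le_compat_r; nra.
- apply C1_at_plus; generalize (locally_height p (-1) 4 Hp); apply filter_imp; auto.
Qed.

(** * Absorbing polynomial factors at high frequency *)

Definition eventually_ge (P : R -> Prop) : Prop := exists K, forall k, K <= k -> P k.

Lemma eventually_ge_and P Q :
  eventually_ge P -> eventually_ge Q -> eventually_ge (fun k => P k /\ Q k).
Proof.
intros [K H] [L H']; exists (Rmax K L); intros k Hk.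
generalize (Rmax_l K L) (Rmax_r K L); intros; split; [apply H|apply H']; lra.
Qed.

Lemma eventually_ge_forall3 (P : nat -> R -> Prop) :
  (forall i, eventually_ge (P i)) ->
  eventually_ge (fun k => forall i, (i < 3)%nat -> P i k).
Proof.
intros H.
destruct (eventually_ge_and _ _ (H 0%nat) (eventually_ge_and _ _ (H 1%nat) (H 2%nat))) as [K HK].
exists K; intros k Hk i Hi; destruct (HK k Hk) as [H0 [H1 H2]].
destruct i as [|[|[|i]]]; auto; lia.
Qed.

(** With N = j + 1, the inequality k/N <= e^(k/N) raised to the power N gives k^(j+1) <= N^(j+1)
    e^k. Hence C k^j e^(-k) <= C N^(j+1) / k. *)
Lemma pow_mul_exp_small C j eps :
  0 <= C -> 0 < eps -> eventually_ge (fun k => C * k ^ j * exp (- k) <= eps).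
Proof.
intros HC He; set (N := INR (S j)).
assert (HN : 0 < N) by (apply lt_0_INR; lia).
assert (HNp : 0 < N ^ S j) by now apply pow_lt.
exists (Rmax 1 (C * N ^ S j / eps)); intros k Hk.
assert (H1 := Rmax_l 1 (C * N ^ S j / eps)); assert (H2 := Rmax_r 1 (C * N ^ S j / eps)).
assert (Hk' : C * N ^ S j <= eps * k).
{ apply Rmult_le_reg_r with (/ eps); [now apply Rinv_0_lt_compat|].
  replace (eps * k * / eps) with k by (field; lra).
  unfold Rdiv in *; lra. }
assert (E : k ^ S j <= N ^ S j * exp k).
{ replace k with (N * (k / N)) at 1 by (field; lra).
  replace (exp k) with (exp (k / N) ^ S j).
  - rewrite Rpow_mult_distr; apply Rmult_le_compat_l; [lra|].
    apply pow_incr; split; [apply Rlt_le, Rdiv_lt_0_compat; lra|].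
    apply Rlt_le, Rlt_trans with (1 + k / N); [lra|apply exp_ineq1].
    apply Rgt_not_eq, Rdiv_lt_0_compat; lra.
  - rewrite <- Rpower_pow by apply exp_pos; unfold Rpower.
    rewrite ln_exp; f_equal; fold N; field; lra. }
assert (He' := exp_pos k).
rewrite exp_Ropp; apply Rmult_le_reg_r with (exp k); auto.
rewrite Rmult_assoc, Rinv_l, Rmult_1_r by lra.
apply Rmult_le_reg_r with k; [lra|].
simpl in E.
apply Rle_trans with (C * (N ^ S j * exp k)); [|nra].
replace (C * k ^ j * k) with (C * (k * k ^ j)) by ring.
apply Rmult_le_compat_l; auto.
Qed.

(** One unit of the decay rate is spent on absorbing the constant and the power of k. *)
Lemma C1_field_small v F eps : 0 < eps -> C1_field (v + 1) F ->
  eventually_ge (fun k => forall p, -1 < coord p 2 < 4 -> C1_at (F k) (eps * exp (- (v * k))) p).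
Proof.
intros He [j [C [HC H]]].
destruct (pow_mul_exp_small C j eps HC He) as [K HK].
exists (Rmax 1 K); intros k Hk p Hp.
assert (H1 := Rmax_l 1 K); assert (H2 := Rmax_r 1 K).
apply C1_at_le with (C * k ^ j * exp (- ((v + 1) * k))); [|apply H; auto; lra].
replace (- ((v + 1) * k)) with (- k + - (v * k)) by ring.
rewrite exp_plus, <- Rmult_assoc; apply Rmult_le_compat_r; [apply Rlt_le, exp_pos|].
apply HK; lra.
Qed.

(** * The trigonometric factors and the profiles of the strip *)

Definition ones (_ _ : R) : R := 1.
Definition cosx (k x : R) : R := cos (k * x).
Definition sinx (k x : R) : R := sin (k * x).
Definition cosy (k y : R) : R := cos (2 * k * y).
Definition siny (k y : R) : R := sin (2 * k * y).

Lemma C1_bound_cos w K x : 0 <= w <= K -> C1_bound (fun s => cos (w * s)) (fun s => - w * sin (w * s)) 1 K x.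
Proof.
intros Hw; split; [|split; [|split]].
- auto_derive; [trivial|ring].
- apply (ex_derive_continuous (V := R_NormedModule)); auto_derive; trivial.
- apply Rabs_le; generalize (COS_bound (w * x)); lra.
- replace K with (K * 1) by ring; apply Rabs_mul_le.
  + rewrite Rabs_Ropp, Rabs_pos_eq; lra.
  + apply Rabs_le; generalize (SIN_bound (w * x)); lra.
Qed.

Lemma C1_bound_sin w K x : 0 <= w <= K -> C1_bound (fun s => sin (w * s)) (fun s => w * cos (w * s)) 1 K x.
Proof.
intros Hw; split; [|split; [|split]].
- auto_derive; [trivial|ring].
- apply (ex_derive_continuous (V := R_NormedModule)); auto_derive; trivial.
- apply Rabs_le; generalize (SIN_bound (w * x)); lra.
- replace K with (K * 1) by ring; apply Rabs_mul_le.
  + rewrite Rabs_pos_eq; lra.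
  + apply Rabs_le; generalize (COS_bound (w * x)); lra.
Qed.

Lemma harmonic_ones : harmonic ones (fun _ _ => 0).
Proof.
intros k x Hk; split; [|split; [|split]]; unfold ones.
- apply (is_derive_const (1 : R)).
- apply continuous_const.
- rewrite Rabs_R1; lra.
- rewrite Rabs_R0; lra.
Qed.
Lemma harmonic_cosx : harmonic cosx (fun k x => - k * sinx k x).
Proof. intros k x Hk; apply C1_bound_cos; lra. Qed.
Lemma harmonic_sinx : harmonic sinx (fun k x => k * cosx k x).
Proof. intros k x Hk; apply C1_bound_sin; lra. Qed.
Lemma harmonic_cosy : harmonic cosy (fun k x => - (2 * k) * siny k x).
Proof. intros k x Hk; apply C1_bound_cos; lra. Qed.
Lemma harmonic_siny : harmonic siny (fun k x => 2 * k * cosy k x).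
Proof. intros k x Hk; apply C1_bound_sin; lra. Qed.

(* On the strip, the mode cos kx with amplitude [fallP] decays at rate k phi', phi = s + 7 step (s - 1),
   and is switched off for 2 < s < 3; the mode cos 2ky with amplitude [riseQ] decays at rate 2k
   and is switched on for 0 < s < 1. *)
Definition psi (k s : R) : R := k * (10 + s + 7 * step (s - 1)).
Definition psi1 (k s : R) : R := k * (1 + 7 * step1 (s - 1)).
Definition psi2 (k s : R) : R := k * (7 * step2 (s - 1)).
Definition fallP (k s : R) : R := damp (1 - step (s - 2)) (exp (- psi k s)).
Definition fallP1 (k s : R) : R :=
  damp1 (1 - step (s - 2)) (- step1 (s - 2)) (psi1 k s) (exp (- psi k s)).
Definition fallP2 (k s : R) : R :=
  damp2 (1 - step (s - 2)) (- step1 (s - 2)) (- step2 (s - 2)) (psi1 k s) (psi2 k s)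
    (exp (- psi k s)).
Definition riseQ (k s : R) : R := damp (step s) (exp (- (k * (12 + 2 * s)))).
Definition riseQ1 (k s : R) : R := damp1 (step s) (step1 s) (2 * k) (exp (- (k * (12 + 2 * s)))).
Definition riseQ2 (k s : R) : R :=
  damp2 (step s) (step1 s) (step2 s) (2 * k) 0 (exp (- (k * (12 + 2 * s)))).
(** This is (psi'^2 - psi'') / k^2, the coefficient a for which P = e^{-psi} solves P'' = k^2 a
    P. *)
Definition coefa (k s : R) : R :=
  (1 + 7 * step1 (s - 1)) * (1 + 7 * step1 (s - 1)) - 7 * step2 (s - 1) * / (1 * k ^ 1).
(** The exponential is the quotient of e^{-k(12 + 2s)} by e^{-k(10 + s)}, the two modes before the
    first one is made to decay faster. *)
Definition beta0 (k s : R) : R :=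
  exp (- (k * (2 + s))) * (beta_num (step s) (step1 s) (step2 s) (2 * k) * / (2 * k ^ 2)).
Definition gamma0 (k s : R) : R :=
  exp (- (k * (2 + s))) * (gamma_num (step s) (step1 s) (step2 s) (2 * k) * / (4 * k ^ 3)).
(** Here the quotient is inverted: once [psi] has gained 7k, e^{-k(17 + s)} is the smaller
    exponential, and e^{-k(5 - s)} is its ratio to e^{-k(12 + 2s)}. *)
Definition beta1 (k s : R) : R :=
  exp (- (k * (5 - s))) *
  (beta_num (1 - step (s - 2)) (- step1 (s - 2)) (- step2 (s - 2)) (1 * k) * / (2 * k ^ 2)).
Definition gamma1 (k s : R) : R :=
  exp (- (k * (5 - s))) *
  (gamma_num (1 - step (s - 2)) (- step1 (s - 2)) (- step2 (s - 2)) (1 * k) * / (2 * k ^ 3)).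

(** For s >= 1 the cutoff is constant, so [beta0] and [gamma0] vanish and the rising mode is exactly
    harmonic. For s < 1 the falling amplitude is exactly e^{-k(10 + s)}. The three identities cancel
    the cross term, match the defect, and allow sin^2 + cos^2 to be collected. *)
Lemma switch_on_identities k s : 1 <= k ->
  beta0 k s * riseQ1 k s = 2 * k * riseQ k s * gamma0 k s /\
  k * fallP k s * beta0 k s = riseQ2 k s / (2 * k) - 2 * k * riseQ k s /\
  beta0 k s * fallP1 k s = - k * fallP k s * beta0 k s.
Proof.
intros Hk; unfold beta0, gamma0, riseQ, riseQ1, riseQ2, fallP, fallP1, damp, damp1, damp2,
  gamma_num, beta_num, psi, psi1.
destruct (Rle_dec 1 s) as [Hs|Hs].
- rewrite step1_right, step2_right by lra; rewrite step_right by lra.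
  repeat split; field; lra.
- rewrite (step_left (s - 1)), (step_left (s - 2)), (step1_left (s - 1)), (step1_left (s - 2)) by lra.
  replace (- (k * (12 + 2 * s))) with (- (k * (10 + s + 7 * 0)) + - (k * (2 + s))) by ring.
  rewrite exp_plus; repeat split; field; lra.
Qed.

(** The same with the modes exchanged: for s <= 2 the choice of [coefa] makes the falling mode
    exact, and for s > 2 [coefa] is 1 while the rising amplitude is a pure exponential. *)
Lemma switch_off_identities k s : 1 <= k ->
  beta1 k s * fallP1 k s = k * fallP k s * gamma1 k s /\
  2 * k * riseQ k s * beta1 k s = fallP2 k s / k - k * coefa k s * fallP k s /\
  beta1 k s * riseQ1 k s = - (2 * k) * riseQ k s * beta1 k s.
Proof.
intros Hk; unfold beta1, gamma1, riseQ, riseQ1, fallP, fallP1, fallP2, damp, damp1, damp2,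
  gamma_num, beta_num, psi, psi1, psi2, coefa.
destruct (Rle_dec s 2) as [Hs|Hs].
- rewrite (step_left (s - 2)), (step1_left (s - 2)), (step2_left (s - 2)) by lra.
  repeat split; field; lra.
- rewrite (step_right (s - 1)), (step1_right (s - 1)), (step2_right (s - 1)),
    (step_right s), (step1_right s) by lra.
  replace (- (k * (10 + s + 7 * 1))) with (- (k * (12 + 2 * s)) + - (k * (5 - s))) by ring.
  rewrite exp_plus; repeat split; field; lra.
Qed.

Definition stage_u (k : R) (p : pt) : R :=
  sep (fallP k) (cosx k) (ones k) p + sep (riseQ k) (ones k) (cosy k) p.

Definition stage_du (i : nat) (k : R) (p : pt) : R :=
  match i with
  | 0%nat => sep (fun s => -1 * k * fallP k s) (sinx k) (ones k) p
  | 1%nat => sep (fun s => -2 * k * riseQ k s) (ones k) (siny k) p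
  | _ => sep (fallP1 k) (cosx k) (ones k) p + sep (riseQ1 k) (ones k) (cosy k) p
  end.

Definition stage_diag (k : R) (i j : nat) (p : pt) : R :=
  match i, j with
  | 0%nat, 0%nat => sep (coefa k) (ones k) (ones k) p
  | 0%nat, _ | _, 0%nat => 0
  | 1%nat, 1%nat => 1
  | 1%nat, _ | _, 1%nat => 0
  | _, _ => 1
  end.

(** Row 1 repairs the switch-on by a flux in y, row 0 the switch-off by a flux in x; the two rows
    have the same shape with the modes exchanged. *)
Definition stage_pert (k : R) (i j : nat) (p : pt) : R :=
  match i, j with
  | 0%nat, 0%nat => sep (gamma1 k) (cosx k) (cosy k) p
  | 0%nat, 1%nat => sep (beta1 k) (sinx k) (siny k) p
  | 0%nat, _ => sep (beta1 k) (sinx k) (cosy k) p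
  | 1%nat, 0%nat => sep (beta0 k) (sinx k) (siny k) p
  | 1%nat, 1%nat => sep (gamma0 k) (cosx k) (cosy k) p
  | 1%nat, _ => sep (beta0 k) (cosx k) (siny k) p
  | _, _ => 0
  end.

Definition stage_A (k : R) (i j : nat) (p : pt) : R :=
  stage_diag k i j p + stage_pert k i j p.

(** The x and y components are antiderivatives of -P'' cos kx and -Q'' cos 2ky, so they balance the
    t-derivative P'' cos kx + Q'' cos 2ky of the last component. *)
Definition stage_flux (k : R) (i : nat) (p : pt) : R :=
  match i with
  | 0%nat => - (fallP2 k (coord p 2) / k) * sinx k (coord p 0)
  | 1%nat => - (riseQ2 k (coord p 2) / (2 * k)) * siny k (coord p 1)
  | _ => stage_du 2 k p
  end.

Lemma stage_flux_eq k i p : 1 <= k -> (i < 3)%nat ->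
  sum3 (fun j => stage_A k i j p * stage_du j k p) = stage_flux k i p.
Proof.
intros Hk Hi; destruct p as [[x y] s]; unfold sum3, stage_A.
destruct (switch_on_identities k s Hk) as [N1 [N2 N3]].
destruct (switch_off_identities k s Hk) as [F1 [F2 F3]].
assert (Sx : sin (k * x) * sin (k * x) = 1 - cos (k * x) * cos (k * x))
  by (generalize (sin2_cos2 (k * x)); unfold Rsqr; lra).
assert (Sy : sin (2 * k * y) * sin (2 * k * y) = 1 - cos (2 * k * y) * cos (2 * k * y))
  by (generalize (sin2_cos2 (2 * k * y)); unfold Rsqr; lra).
destruct i as [|[|[|i]]]; [| | |lia]; unfold stage_diag, stage_pert, stage_flux, stage_du, sep,
  ones, cosx, sinx, cosy, siny; simpl fst; simpl snd; simpl coord.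
- replace (fallP2 k s / k) with (2 * k * riseQ k s * beta1 k s + k * coefa k s * fallP k s) by lra.
  set (sx := sin (k * x)) in *; set (sy := sin (2 * k * y)) in *;
  set (cx := cos (k * x)) in *; set (cy := cos (2 * k * y)) in *.
  (* The bracket after sx cx cy is zero by the choice of [gamma1]; the last two terms share a factor
     and combine through sin^2 + cos^2 = 1. *)
  transitivity (- k * coefa k s * fallP k s * sx
    + sx * cx * cy * (beta1 k s * fallP1 k s - k * fallP k s * gamma1 k s)
    - 2 * k * riseQ k s * beta1 k s * sx * (sy * sy) + sx * (cy * cy) * (beta1 k s * riseQ1 k s)).
  { ring. }
  rewrite F1, F3, Sy; ring.
- replace (riseQ2 k s / (2 * k)) with (k * fallP k s * beta0 k s + 2 * k * riseQ k s) by lra.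
  set (sx := sin (k * x)) in *; set (sy := sin (2 * k * y)) in *;
  set (cx := cos (k * x)) in *; set (cy := cos (2 * k * y)) in *.
  transitivity (- 2 * k * riseQ k s * sy
    + sy * cx * cy * (beta0 k s * riseQ1 k s - 2 * k * riseQ k s * gamma0 k s)
    - k * fallP k s * beta0 k s * sy * (sx * sx) + sy * (cx * cx) * (beta0 k s * fallP1 k s)).
  { ring. }
  rewrite N1, N3, Sx; ring.
- ring.
Qed.

(** * Decay rates of the amplitudes and of the perturbation *)

Lemma decay_step c : C1_decay_poly 0 (fun _ s => step (s - c)) (fun _ s => step1 (s - c)).
Proof.
exists 0%nat; apply C1_decay_profile; [apply is_derive_step| |intros s|apply step1_le].
- intros s; apply (ex_derive_continuous (V := R_NormedModule)); eexists; apply is_derive_step1.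
- apply Rabs_le; generalize (step_bounds s); lra.
Qed.

Lemma decay_step1 c : C1_decay_poly 0 (fun _ s => step1 (s - c)) (fun _ s => step2 (s - c)).
Proof.
exists 0%nat; apply C1_decay_profile;
  [apply is_derive_step1| |apply step1_le|apply step2_le].
intros s; apply (ex_derive_continuous (V := R_NormedModule)); eexists; apply is_derive_step2.
Qed.

Lemma decay_step2 c : C1_decay_poly 0 (fun _ s => step2 (s - c)) (fun _ s => step3 (s - c)).
Proof.
exists 0%nat; apply C1_decay_profile;
  [apply is_derive_step2|apply continuous_step3|apply step2_le|apply step3_le].
Qed.

Lemma decay_const c : C1_decay_poly 0 (fun _ _ => c) (fun _ _ => 0).
Proof.
exists 0%nat; apply C1_decay_coef; exists (Rabs c); split; [apply Rabs_pos|].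
intros; simpl; lra.
Qed.

Lemma decay_rise : C1_decay_poly 0 (fun _ s => step s) (fun _ s => step1 s).
Proof.
apply C1_decay_poly_ext with (3 := decay_step 0); intros; f_equal; ring.
Qed.

Lemma decay_rise1 : C1_decay_poly 0 (fun _ s => step1 s) (fun _ s => step2 s).
Proof.
apply C1_decay_poly_ext with (3 := decay_step1 0); intros; f_equal; ring.
Qed.

Lemma decay_rise2 : C1_decay_poly 0 (fun _ s => step2 s) (fun _ s => step3 s).
Proof.
apply C1_decay_poly_ext with (3 := decay_step2 0); intros; f_equal; ring.
Qed.

Lemma decay_fall :
  C1_decay_poly 0 (fun _ s => 1 - step (s - 2)) (fun _ s => - step1 (s - 2)).
Proof.
eapply C1_decay_poly_ext; [| |exact (C1_decay_poly_sub _ _ _ _ _ (decay_const 1) (decay_step 2))];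
  intros; simpl; ring.
Qed.

Lemma decay_fall1 :
  C1_decay_poly 0 (fun _ s => - step1 (s - 2)) (fun _ s => - step2 (s - 2)).
Proof.
eapply C1_decay_poly_ext; [| |exact (C1_decay_poly_const _ _ _ (-1) (decay_step1 2))];
  intros; simpl; ring.
Qed.

Lemma decay_fall2 :
  C1_decay_poly 0 (fun _ s => - step2 (s - 2)) (fun _ s => - step3 (s - 2)).
Proof.
eapply C1_decay_poly_ext; [| |exact (C1_decay_poly_const _ _ _ (-1) (decay_step2 2))];
  intros; simpl; ring.
Qed.

Lemma decay_linear_exp w a b c :
  (forall s, -1 < s < 4 -> w <= a + b * s) -> c = b ->
  C1_decay_poly w (fun k s => exp (- (k * (a + b * s))))
    (fun k s => - (c * k) * exp (- (k * (a + b * s)))).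
Proof.
intros H ->; apply (C1_decay_poly_exp w (fun k s => k * (a + b * s)) (fun k _ => b * k) (fun _ _ => 0)).
- intros k s Hk Hs; split; [auto_derive; [trivial|ring]|].
  rewrite (Rmult_comm w); apply Rmult_le_compat_l; [lra|auto].
- apply C1_decay_poly_freq.
Qed.

Lemma decay_psi1 : C1_decay_poly 0 psi1 psi2.
Proof.
eapply C1_decay_poly_ext; [| |eapply C1_decay_poly_mul; [apply (C1_decay_poly_freq 1)|
  eapply C1_decay_poly_add; [apply (decay_const 1)|
  apply C1_decay_poly_const with (c := 7); apply (decay_step1 1)]]];
  intros; unfold psi1, psi2; simpl; ring.
Qed.

(** The exponent is at least 9k on the range of s. Rate 2 suffices: one unit will absorb polynomial
    factors and the other leaves the bound e^{-k} for the solution. *)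
Lemma decay_fall_exp :
  C1_decay_poly 2 (fun k s => exp (- psi k s)) (fun k s => - psi1 k s * exp (- psi k s)).
Proof.
apply C1_decay_poly_exp with psi2; [|apply decay_psi1].
intros k s Hk Hs; split.
- unfold psi, psi1.
  assert (D : is_derive (fun s => step (s - 1)) s (step1 (s - 1))).
  { replace (step1 (s - 1)) with (1 * step1 (s - 1)) by ring.
    apply (is_derive_comp step (fun s => s - 1)); [apply is_derive_step|].
    auto_derive; [trivial|ring]. }
  eapply is_derive_cmul; [|reflexivity].
  eapply is_derive_add; [|eapply is_derive_cmul; [exact D|reflexivity]|reflexivity].
  auto_derive; [trivial|ring].
- unfold psi; rewrite (Rmult_comm 2); apply Rmult_le_compat_l; [lra|].
  generalize (step_bounds (s - 1)); lra.
Qed.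

Lemma decay_rise_exp :
  C1_decay_poly 2 (fun k s => exp (- (k * (12 + 2 * s))))
    (fun k s => - (2 * k) * exp (- (k * (12 + 2 * s)))).
Proof. apply decay_linear_exp; [intros; lra|reflexivity]. Qed.

Lemma decay_fallP : C1_decay_poly 2 fallP fallP1.
Proof.
exact (C1_decay_poly_damp _ _ _ _ _ _ decay_fall decay_psi1 decay_fall_exp).
Qed.

Lemma decay_fallP1 : C1_decay_poly 2 fallP1 fallP2.
Proof.
exact (C1_decay_poly_damp1 _ _ _ _ _ _ _ decay_fall decay_fall1 decay_psi1 decay_fall_exp).
Qed.

Lemma decay_riseQ : C1_decay_poly 2 riseQ riseQ1.
Proof.
exact (C1_decay_poly_damp _ _ _ (fun k _ => 2 * k) _ _ decay_rise (C1_decay_poly_freq 2) decay_rise_exp).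
Qed.

Lemma decay_riseQ1 : C1_decay_poly 2 riseQ1 riseQ2.
Proof.
exact (C1_decay_poly_damp1 _ _ _ _ (fun k _ => 2 * k) _ _ decay_rise decay_rise1
  (C1_decay_poly_freq 2) decay_rise_exp).
Qed.

(** Rate 1 comes from 2 + s > 1 for s > -1; for [beta1] and [gamma1] it comes from 5 - s > 1 for s <
    4. *)
Lemma decay_beta0 : exists f', C1_decay_poly 1 beta0 f'.
Proof.
destruct (C1_decay_poly_beta_num _ _ _ _ 2 decay_rise decay_rise1 decay_rise2) as [n Hn].
eexists; eapply C1_decay_poly_ext.
3: eapply C1_decay_poly_mul; [apply (decay_linear_exp 1 2 1 1); [intros; lra|reflexivity]|
  eapply C1_decay_poly_mul; [exact Hn|apply (C1_decay_poly_inv 2 2); lra]].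
- intros; unfold beta0; rewrite Rmult_1_l; reflexivity.
- reflexivity.
Qed.

Lemma decay_gamma0 : exists f', C1_decay_poly 1 gamma0 f'.
Proof.
destruct (C1_decay_poly_gamma_num _ _ _ _ 2 decay_rise decay_rise1 decay_rise2) as [n Hn].
eexists; eapply C1_decay_poly_ext.
3: eapply C1_decay_poly_mul; [apply (decay_linear_exp 1 2 1 1); [intros; lra|reflexivity]|
  eapply C1_decay_poly_mul; [exact Hn|apply (C1_decay_poly_inv 4 3); lra]].
- intros; unfold gamma0; rewrite Rmult_1_l; reflexivity.
- reflexivity.
Qed.

Lemma decay_beta1 : exists f', C1_decay_poly 1 beta1 f'.
Proof.
destruct (C1_decay_poly_beta_num _ _ _ _ 1 decay_fall decay_fall1 decay_fall2) as [n Hn].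
eexists; eapply C1_decay_poly_ext.
3: eapply C1_decay_poly_mul; [apply (decay_linear_exp 1 5 (-1) (-1)); [intros; lra|reflexivity]|
  eapply C1_decay_poly_mul; [exact Hn|apply (C1_decay_poly_inv 2 2); lra]].
- intros k s _; unfold beta1; replace (5 + -1 * s) with (5 - s) by ring; reflexivity.
- reflexivity.
Qed.

Lemma decay_gamma1 : exists f', C1_decay_poly 1 gamma1 f'.
Proof.
destruct (C1_decay_poly_gamma_num _ _ _ _ 1 decay_fall decay_fall1 decay_fall2) as [n Hn].
eexists; eapply C1_decay_poly_ext.
3: eapply C1_decay_poly_mul; [apply (decay_linear_exp 1 5 (-1) (-1)); [intros; lra|reflexivity]|
  eapply C1_decay_poly_mul; [exact Hn|apply (C1_decay_poly_inv 2 3); lra]].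
- intros k s _; unfold gamma1; replace (5 + -1 * s) with (5 - s) by ring; reflexivity.
- reflexivity.
Qed.

Lemma C1_field_zero w : C1_field w (fun _ _ => 0).
Proof.
exists 0%nat, 0; split; [lra|]; intros k p Hk Hp.
apply C1_at_const; rewrite Rabs_R0; lra.
Qed.

Lemma C1_field_pert i j : C1_field 1 (fun k => stage_pert k i j).
Proof.
destruct decay_beta0 as [b0 B0], decay_gamma0 as [g0 G0], decay_beta1 as [b1 B1],
  decay_gamma1 as [g1 G1].
destruct i as [|[|i]]; [destruct j as [|[|j]]|destruct j as [|[|j]]|apply C1_field_zero];
  eapply C1_field_sep; eauto using harmonic_cosx, harmonic_sinx, harmonic_cosy, harmonic_siny.
Qed.

Lemma C1_field_u : C1_field 2 stage_u.
Proof.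
apply (C1_field_plus 2 (fun k => sep (fallP k) (cosx k) (ones k))
  (fun k => sep (riseQ k) (ones k) (cosy k))); eapply C1_field_sep;
  eauto using harmonic_cosx, harmonic_ones, harmonic_cosy, decay_fallP, decay_riseQ.
Qed.

Lemma C1_field_du i : C1_field 2 (stage_du i).
Proof.
destruct i as [|[|i]].
- apply (C1_field_sep 2 (fun k s => -1 * k * fallP k s) (fun k s => fallP1 k s * (-1 * k) + fallP k s * 0)
    sinx (fun k x => k * cosx k x) ones (fun _ _ => 0)); auto using harmonic_sinx, harmonic_ones.
  eapply C1_decay_poly_ext; [| |eapply C1_decay_poly_mul;
    [apply decay_fallP|apply (C1_decay_poly_freq (-1))]]; intros; simpl; ring.
- apply (C1_field_sep 2 (fun k s => -2 * k * riseQ k s) (fun k s => riseQ1 k s * (-2 * k) + riseQ k s * 0)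
    ones (fun _ _ => 0) siny (fun k x => 2 * k * cosy k x)); auto using harmonic_siny, harmonic_ones.
  eapply C1_decay_poly_ext; [| |eapply C1_decay_poly_mul;
    [apply decay_riseQ|apply (C1_decay_poly_freq (-2))]]; intros; simpl; ring.
- apply (C1_field_plus 2 (fun k => sep (fallP1 k) (cosx k) (ones k))
    (fun k => sep (riseQ1 k) (ones k) (cosy k))); eapply C1_field_sep;
    eauto using harmonic_cosx, harmonic_ones, harmonic_cosy, decay_fallP1, decay_riseQ1.
Qed.

(** The amplitudes are left general so that one computation serves both the solution and its
    t-derivative. *)
Lemma is_derive_stage_sum g g' f f' k p i : 1 <= k -> -1 < coord p 2 < 4 ->
  C1_decay_poly 2 g g' -> C1_decay_poly 2 f f' ->
  is_derive (fun s => sep (g k) (cosx k) (ones k) (upd p i s)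
                    + sep (f k) (ones k) (cosy k) (upd p i s)) (coord p i)
    (match i with
     | 0%nat => sep (fun s => -1 * k * g k s) (sinx k) (ones k) p
     | 1%nat => sep (fun s => -2 * k * f k s) (ones k) (siny k) p
     | _ => sep (g' k) (cosx k) (ones k) p + sep (f' k) (ones k) (cosy k) p
     end).
Proof.
intros Hk Hp [i1 [C1 [_ Hg]]] [i2 [C2 [_ Hf]]].
assert (D1 := is_derive_sep (g k) (g' k) (cosx k) (fun x => - k * sinx k x) (ones k) (fun _ => 0)
  (-1) 4 _ _ p i (fun s => Hg k s Hk)
  (fun x => harmonic_cosx k x Hk) (fun x => harmonic_ones k x Hk) Hp).
assert (D2 := is_derive_sep (f k) (f' k) (ones k) (fun _ => 0) (cosy k) (fun x => - (2 * k) * siny k x)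
  (-1) 4 _ _ p i (fun s => Hf k s Hk)
  (fun x => harmonic_ones k x Hk) (fun x => harmonic_cosy k x Hk) Hp).
eapply is_derive_add; [exact D1|exact D2|].
destruct i as [|[|i]]; unfold sep; simpl; unfold ones; ring.
Qed.

Lemma partial_stage_u k p i : 1 <= k -> -1 < coord p 2 < 4 ->
  partial i (stage_u k) p = stage_du i k p.
Proof.
intros Hk Hp; apply partial_is_derive.
exact (is_derive_stage_sum _ _ _ _ k p i Hk Hp decay_fallP decay_riseQ).
Qed.

Lemma stage_div k p : 1 <= k -> -1 < coord p 2 < 4 ->
  div_A_grad (stage_A k) (stage_u k) p = 0.
Proof.
intros Hk Hp; unfold div_A_grad.
assert (E : forall i, (i < 3)%nat ->
  partial i (fun q => sum3 (fun j => stage_A k i j q * partial j (stage_u k) q)) p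
  = partial i (stage_flux k i) p).
{ intros i Hi; apply partial_ext_loc.
  generalize (locally_height p (-1) 4 Hp); apply filter_imp; intros q Hq.
  rewrite <- stage_flux_eq by auto; unfold sum3; now rewrite !partial_stage_u. }
unfold sum3 at 1; rewrite !E by lia.
assert (E2 : partial 2 (stage_flux k 2) p = sep (fallP2 k) (cosx k) (ones k) p + sep (riseQ2 k) (ones k) (cosy k) p).
{ apply partial_is_derive.
  exact (is_derive_stage_sum _ _ _ _ k p 2 Hk Hp decay_fallP1 decay_riseQ1). }
rewrite E2; clear E E2; destruct p as [[x y] t].
(* The second derivatives of the amplitudes are constants for the x and y derivatives, so no third
   derivative appears. *)
rewrite (partial_is_derive 0 _ _ (- fallP2 k t * cosx k x)).
2: { simpl; unfold sinx, cosx; auto_derive; [trivial|field; lra]. }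
rewrite (partial_is_derive 1 _ _ (- riseQ2 k t * cosy k y)).
2: { simpl; unfold siny, cosy; auto_derive; [trivial|field; lra]. }
unfold sep, ones; simpl; ring.
Qed.

(** * Gluing the strips *)

(** This coefficient is not small, so its C^1 bound must be free of powers of k for the matrix to be
    uniformly C^1 over all strips. *)
Lemma coefa_C1 : exists f', C1_decay 0 0 coefa f'.
Proof.
assert (S1 : C1_decay 0 0 (fun _ s => 1 + step1 (s - 1) * 7) (fun _ s => 0 + (step2 (s - 1) * 7 + step1 (s - 1) * 0))).
{ apply (C1_decay_add 0 0 (fun _ _ => 1) (fun _ _ => 0) (fun _ s => step1 (s - 1) * 7)).
  - apply C1_decay_coef; exists 1; split; [lra|]; intros; rewrite Rabs_R1; simpl; lra.
  - apply (C1_decay_mul 0 0 0 (fun _ s => step1 (s - 1)) (fun _ s => step2 (s - 1)) (fun _ _ => 7) (fun _ _ => 0)).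
    + apply C1_decay_profile; [apply is_derive_step1| |apply step1_le|apply step2_le].
      intros s; apply (ex_derive_continuous (V := R_NormedModule)); eexists; apply is_derive_step2.
    + apply C1_decay_coef; exists 7; split; [lra|]; intros; rewrite Rabs_pos_eq; simpl; lra. }
assert (S2 : C1_decay 0 0 (fun k s => step2 (s - 1) * (-7 * / (1 * k ^ 1)))
  (fun k s => step3 (s - 1) * (-7 * / (1 * k ^ 1)) + step2 (s - 1) * 0)).
{ apply (C1_decay_mul 0 0 0 (fun _ s => step2 (s - 1)) (fun _ s => step3 (s - 1))
    (fun k _ => -7 * / (1 * k ^ 1)) (fun _ _ => 0)).
  - apply C1_decay_profile; [apply is_derive_step2|apply continuous_step3|apply step2_le|apply step3_le].
  - apply C1_decay_coef; exists 7; split; [lra|]; intros k Hk.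
    rewrite Rabs_mult, (Rabs_left (-7)) by lra.
    assert (0 < / (1 * k ^ 1) <= 1).
    { simpl; rewrite Rmult_1_l, Rmult_1_r; split; [apply Rinv_0_lt_compat; lra|].
      rewrite <- Rinv_1; apply Rinv_le_contravar; lra. }
    rewrite Rabs_pos_eq; simpl in *; lra. }
eexists; eapply C1_decay_ext; [| |eapply C1_decay_add; [exact (C1_decay_mul _ _ _ _ _ _ _ S1 S1)|exact S2]].
- intros k s _; unfold coefa; ring.
- intros; reflexivity.
Qed.

Lemma C1_at_stage_diag : exists M, forall k p, 1 <= k -> -1 < coord p 2 < 4 ->
  forall i j, C1_at (stage_diag k i j) M p.
Proof.
destruct coefa_C1 as [a' [C [HC H]]]; exists (C + 1); intros k p Hk Hp i j.
assert (H1 : forall x, C1_bound (ones k) (fun _ => 0) 1 1 x).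
{ intros x; split; [apply (is_derive_const (1 : R))|split; [apply continuous_const|split]].
  - unfold ones; rewrite Rabs_R1; lra.
  - rewrite Rabs_R0; lra. }
destruct i as [|[|i]], j as [|[|j]];
  try (apply (C1_at_const 0); rewrite Rabs_R0; lra);
  try (apply (C1_at_const 1); rewrite Rabs_R1; lra).
apply C1_at_le with (C * 1); [lra|].
apply (C1_at_sep (coefa k) (a' k) (ones k) (fun _ => 0) (ones k) (fun _ => 0) (-1) 4); auto; [|lra].
intros s Hs; generalize (H k s Hk Hs).
now rewrite Rmult_0_l, Ropp_0, exp_0, !Rmult_1_r.
Qed.

(** Since 56000 = 2 * 7 * 4000, the term with [step2] is at most 1/2 in absolute value; the square
    lies between 1 and 28001^2. *)
Lemma coefa_bounds k s : 56000 <= k -> 1 / 2 <= coefa k s <= 10 ^ 9.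
Proof.
intros Hk; unfold coefa.
assert (H1 := step1_ge0 (s - 1)); assert (H2 := step1_le (s - 1)).
assert (H3 := step2_le (s - 1)).
rewrite Rabs_pos_eq in H2 by auto; apply Rabs_le_between in H3.
assert (0 < / (1 * k ^ 1) <= / 56000).
{ rewrite pow_1, Rmult_1_l; split; [apply Rinv_0_lt_compat; lra|apply Rinv_le_contravar; lra]. }
set (a := step1 (s - 1)) in *; set (b := step2 (s - 1)) in *; set (r := / (1 * k ^ 1)) in *.
assert (- (1 / 2) <= 7 * b * r <= 1 / 2) by (split; nra).
split; nra.
Qed.

(** * Strip coordinates, with x and y exchanged on odd strips *)

Definition swap_index (n i : nat) : nat :=
  if Nat.even n then i else match i with 0%nat => 1%nat | 1%nat => 0%nat | _ => i end.

Definition to_stage (n : nat) (p : pt) : pt :=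
  match p with (x, y, t) =>
    if Nat.even n then (x, y, t - 4 * INR n) else (y, x, t - 4 * INR n) end.

Lemma swap_index_lt n i : (i < 3)%nat -> (swap_index n i < 3)%nat.
Proof. unfold swap_index; destruct (Nat.even n), i as [|[|i]]; lia. Qed.

Lemma height_to_stage n p : coord (to_stage n p) 2 = coord p 2 - 4 * INR n.
Proof. destruct p as [[x y] t]; unfold to_stage; now destruct (Nat.even n). Qed.

Lemma sum3_swap n g : sum3 (fun i => g (swap_index n i)) = sum3 g.
Proof. unfold sum3, swap_index; destruct (Nat.even n); ring. Qed.

Lemma locally_to_stage n p Q :
  locally (to_stage n p) Q -> locally p (fun q => Q (to_stage n q)).
Proof.
intros [eps H]; exists eps; intros q Hq; apply H; clear H.
destruct p as [[x y] t], q as [[x' y'] t'], Hq as [[Hx Hy] Ht]; simpl in *.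
assert (Ht' : ball (t - 4 * INR n) eps (t' - 4 * INR n)).
{ change (Rabs (t' - 4 * INR n - (t - 4 * INR n)) < eps).
  replace (t' - 4 * INR n - (t - 4 * INR n)) with (t' - t) by ring; exact Ht. }
destruct (Nat.even n); repeat split; auto.
Qed.

Lemma upd_to_stage n p i s :
  to_stage n (upd p i s) =
  upd (to_stage n p) (swap_index n i) (match i with 0%nat | 1%nat => s | _ => s - 4 * INR n end).
Proof.
destruct p as [[x y] t]; unfold to_stage, swap_index; destruct (Nat.even n), i as [|[|i]]; reflexivity.
Qed.

Lemma coord_to_stage n p i :
  coord (to_stage n p) (swap_index n i) =
  match i with 0%nat | 1%nat => coord p i | _ => coord p i - 4 * INR n end.
Proof.
destruct p as [[x y] t]; unfold to_stage, swap_index; destruct (Nat.even n), i as [|[|i]]; reflexivity.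
Qed.

(** The difference quotients coincide, so no differentiability is required and [partial_to_stage]
    holds for every function. *)
Lemma Derive_shift f x c : Derive (fun s => f (s - c)) x = Derive f (x - c).
Proof.
unfold Derive; f_equal; apply Lim_ext; intros h.
now replace (x + h - c) with (x - c + h) by ring.
Qed.

Lemma partial_to_stage n f p i :
  partial i (fun q => f (to_stage n q)) p = partial (swap_index n i) f (to_stage n p).
Proof.
unfold partial; rewrite coord_to_stage.
rewrite (Derive_ext _ _ _ (fun s => f_equal f (upd_to_stage n p i s))).
destruct i as [|[|i]]; auto.
apply (Derive_shift (fun s => f (upd (to_stage n p) (swap_index n (S (S i))) s))).
Qed.

Lemma continuous_to_stage n (f : pt -> R) p :
  continuous f (to_stage n p) -> continuous (fun q => f (to_stage n q)) p.
Proof. intros H P HP; apply (locally_to_stage n p (fun q => P (f q))); exact (H P HP). Qed.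

Lemma C1_at_to_stage n f M p :
  C1_at f M (to_stage n p) -> C1_at (fun q => f (to_stage n q)) M p.
Proof.
intros [Hc [Hb Hd]]; split; [now apply continuous_to_stage|split; auto]; intros i Hi.
destruct (Hd _ (swap_index_lt n i Hi)) as [H1 [H2 H3]]; split; [|split].
- apply ex_derive_ext with (fun s => f (upd (to_stage n p) (swap_index n i)
    (match i with 0%nat | 1%nat => s | _ => s - 4 * INR n end))).
  { intros s; now rewrite upd_to_stage. }
  rewrite coord_to_stage in H1.
  destruct i as [|[|i]]; auto.
  apply (ex_derive_comp (fun s => f (upd (to_stage n p) (swap_index n (S (S i))) s)) (fun s => s - 4 * INR n)); auto.
  auto_derive; trivial.
- apply continuous_ext with (fun q => partial (swap_index n i) f (to_stage n q)).
  + intros q; now rewrite partial_to_stage.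
  + now apply continuous_to_stage.
- now rewrite partial_to_stage.
Qed.

(** * Functions glued from their strips *)

Definition stage_index (p : pt) : nat := Z.to_nat (Int_part (coord p 2 / 4)).

Lemma stage_index_spec p : Omega p ->
  4 * INR (stage_index p) <= coord p 2 < 4 * INR (stage_index p) + 4.
Proof.
unfold Omega, stage_index; intros Hp.
destruct (base_Int_part (coord p 2 / 4)) as [H1 H2].
assert (0 <= Int_part (coord p 2 / 4))%Z.
{ apply Z.lt_succ_r; apply lt_IZR; unfold Z.succ; rewrite plus_IZR; lra. }
rewrite INR_IZR_INZ, Z2Nat.id by auto; lra.
Qed.

Lemma stage_index_eq p n : Omega p ->
  4 * INR n <= coord p 2 < 4 * INR n + 4 -> stage_index p = n.
Proof.
intros Hp Hn; destruct (stage_index_spec p Hp) as [H1 H2].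
assert (stage_index p < S n)%nat by (apply INR_lt; rewrite S_INR; lra).
assert (n < S (stage_index p))%nat by (apply INR_lt; rewrite S_INR; lra).
lia.
Qed.

Definition glue (F : nat -> pt -> R) (p : pt) : R :=
  F (stage_index p) (to_stage (stage_index p) p).

(** Agreement is asked on the last quarter of each strip, where the old mode is gone and the next
    one has not begun to appear. *)
Definition compatible (F : nat -> pt -> R) : Prop :=
  forall n p, 4 * INR n + 3 < coord p 2 < 4 * INR n + 4 ->
    F n (to_stage n p) = F (S n) (to_stage (S n) p).

Lemma glue_eq F n p : compatible F -> Omega p ->
  4 * INR n - 1 < coord p 2 < 4 * INR n + 4 -> glue F p = F n (to_stage n p).
Proof.
intros HF Hp Hn; unfold glue.
destruct (Rle_dec (4 * INR n) (coord p 2)) as [H|H].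
- now rewrite (stage_index_eq p n) by (auto; lra).
(* Below the strip, n = 0 would put the point outside the half-space; otherwise it lies in the last
   quarter of the preceding strip. *)
- destruct n as [|n]; [simpl in H; unfold Omega in Hp; lra|].
  rewrite S_INR in *.
  rewrite (stage_index_eq p n) by (auto; lra).
  apply HF; lra.
Qed.

(** Because the formula of a strip stays valid one unit below it, it holds on a full neighbourhood
    of [p] even when [p] lies on the junction. *)
Lemma glue_eq_loc F p : compatible F -> Omega p ->
  locally p (fun q => Omega q /\ -1 < coord (to_stage (stage_index p) q) 2 < 4
    /\ glue F q = F (stage_index p) (to_stage (stage_index p) q)).
Proof.
intros HF Hp; set (n := stage_index p).
assert (Hn := stage_index_spec p Hp); fold n in Hn.
assert (L1 : locally p (fun q => 4 * INR n - 1 < coord q 2 < 4 * INR n + 4))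
  by (apply locally_height; lra).
assert (L2 : locally p (fun q => 0 < coord q 2 < coord p 2 + 1))
  by (apply locally_height; unfold Omega in Hp; lra).
generalize (filter_and _ _ L1 L2); apply filter_imp; intros q [H1 [H2 _]].
split; [exact H2|split; [rewrite height_to_stage; lra|now apply glue_eq]].
Qed.

Lemma C1_at_glue F M p : compatible F -> Omega p ->
  (forall n q, -1 < coord q 2 < 4 -> C1_at (F n) M q) -> C1_at (glue F) M p.
Proof.
intros HF Hp H.
assert (L := glue_eq_loc F p HF Hp).
apply C1_at_ext_loc with (fun q => F (stage_index p) (to_stage (stage_index p) q)).
- revert L; apply filter_imp; intros q Hq; apply Hq.
- apply C1_at_to_stage, H, (locally_singleton _ _ L).
Qed.

Lemma partial_glue_loc F p i : compatible F -> Omega p ->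
  locally p (fun q => partial i (glue F) q =
    partial (swap_index (stage_index p) i) (F (stage_index p)) (to_stage (stage_index p) q)).
Proof.
intros HF Hp; assert (L := glue_eq_loc F p HF Hp).
apply locally_locally in L; revert L; apply filter_imp; intros q Hq.
rewrite <- partial_to_stage; apply partial_ext_loc.
revert Hq; apply filter_imp; intros r Hr; apply Hr.
Qed.

(** * Periodicity and agreement of consecutive strips *)

Lemma periodic_glue F : (forall n, periodic_xy (F n)) -> periodic_xy (glue F).
Proof.
intros H x y t; unfold glue.
change (stage_index (x + 2 * PI, y, t)) with (stage_index (x, y, t)).
change (stage_index (x, y + 2 * PI, t)) with (stage_index (x, y, t)).
unfold to_stage; destruct (Nat.even (stage_index (x, y, t))); split; apply H.
Qed.

Lemma harmonic_periodic m x :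
  (cosx (INR m) (x + 2 * PI) = cosx (INR m) x /\ sinx (INR m) (x + 2 * PI) = sinx (INR m) x) /\
  (cosy (INR m) (x + 2 * PI) = cosy (INR m) x /\ siny (INR m) (x + 2 * PI) = siny (INR m) x).
Proof.
unfold cosx, sinx, cosy, siny.
replace (INR m * (x + 2 * PI)) with (INR m * x + 2 * INR m * PI) by ring.
replace (2 * INR m * (x + 2 * PI)) with (2 * INR m * x + 2 * INR (2 * m) * PI)
  by (rewrite mult_INR; simpl (INR 2); ring).
now rewrite !cos_period, !sin_period.
Qed.

Lemma periodic_stage_u m : periodic_xy (stage_u (INR m)).
Proof.
intros x y t; unfold stage_u, sep; simpl.
destruct (harmonic_periodic m x) as [[-> _] _], (harmonic_periodic m y) as [_ [-> _]].
now split.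
Qed.

Lemma periodic_stage_A m i j : periodic_xy (stage_A (INR m) i j).
Proof.
intros x y t; unfold stage_A, stage_diag, stage_pert, sep.
destruct (harmonic_periodic m x) as [[Cx Sx] _], (harmonic_periodic m y) as [_ [Cy Sy]].
destruct i as [|[|i]], j as [|[|j]]; simpl; rewrite ?Cx, ?Sx, ?Cy, ?Sy; now split.
Qed.

(** The offsets 10 and 12 are tuned to 2 (10 + (s - 4)) = 12 + 2s: the surviving mode cos 2ky is the
    falling mode of the next strip. *)
Lemma stage_u_match k x y s : 3 < s < 4 -> stage_u k (x, y, s) = stage_u (2 * k) (y, x, s - 4).
Proof.
intros Hs; unfold stage_u, sep, fallP, riseQ, damp, psi, ones, cosx, cosy; simpl.
rewrite (step_right (s - 2)), (step_right s) by lra.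
rewrite (step_left (s - 4 - 2)), (step_left (s - 4)), (step_left (s - 4 - 1)) by lra.
replace (2 * k * (10 + (s - 4) + 7 * 0)) with (k * (12 + 2 * s)) by ring.
ring.
Qed.

Lemma stage_A_match k i j x y s : 3 < s < 4 ->
  stage_A k i j (x, y, s) = stage_A (2 * k) (swap_index 1 i) (swap_index 1 j) (y, x, s - 4).
Proof.
intros Hs; unfold stage_A, stage_diag, stage_pert, sep, swap_index, ones; simpl Nat.even.
(* All derivatives of the cutoffs vanish there, so both matrices are the identity. *)
assert (Z : forall k s, s <= 0 \/ 3 <= s -> beta0 k s = 0 /\ gamma0 k s = 0 /\ beta1 k s = 0 /\ gamma1 k s = 0
  /\ coefa k s = 1).
{ clear; intros k s Hs; unfold beta0, gamma0, beta1, gamma1, gamma_num, beta_num, coefa.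
  destruct Hs.
  - rewrite (step1_left s), (step2_left s), (step1_left (s - 2)), (step2_left (s - 2)),
      (step1_left (s - 1)), (step2_left (s - 1)) by lra. repeat split; ring.
  - rewrite (step1_right s), (step2_right s), (step1_right (s - 2)), (step2_right (s - 2)),
      (step1_right (s - 1)), (step2_right (s - 1)) by lra. repeat split; ring. }
destruct (Z k s) as [B0 [G0 [B1 [G1 A]]]]; [lra|].
destruct (Z (2 * k) (s - 4)) as [B0' [G0' [B1' [G1' A']]]]; [lra|].
destruct i as [|[|i]], j as [|[|j]]; simpl;
  rewrite ?B0, ?G0, ?B1, ?G1, ?A, ?B0', ?G0', ?B1', ?G1', ?A'; ring.
Qed.

(** * The global solution and matrix, with integer frequencies *)

Definition freq (m n : nat) : nat := m * 2 ^ n.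

Lemma freq_S m n : INR (freq m (S n)) = 2 * INR (freq m n).
Proof. unfold freq; simpl; rewrite !mult_INR, plus_INR, plus_INR; simpl; ring. Qed.

Lemma freq_ge m n : INR m * 2 ^ n = INR (freq m n).
Proof. unfold freq; now rewrite mult_INR, pow_INR. Qed.

Lemma to_stage_S n p x y t : to_stage n p = (x, y, t) -> to_stage (S n) p = (y, x, t - 4).
Proof.
destruct p as [[x' y'] t']; unfold to_stage; rewrite S_INR, Nat.even_succ, <- Nat.negb_even.
destruct (Nat.even n); simpl; intros H; injection H; intros; subst; f_equal; ring.
Qed.

Lemma swap_index_S n i : swap_index (S n) i = swap_index 1 (swap_index n i).
Proof.
unfold swap_index; rewrite Nat.even_succ, <- Nat.negb_even.
destruct (Nat.even n), i as [|[|i]]; reflexivity.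
Qed.

Definition global_u (m : nat) : pt -> R := glue (fun n => stage_u (INR (freq m n))).
Definition global_A (m i j : nat) : pt -> R :=
  glue (fun n => stage_A (INR (freq m n)) (swap_index n i) (swap_index n j)).

Lemma compatible_u m : compatible (fun n => stage_u (INR (freq m n))).
Proof.
intros n p Hp; destruct (to_stage n p) as [[x y] s] eqn:E.
rewrite (to_stage_S n p x y s E), freq_S; apply stage_u_match.
generalize (height_to_stage n p); rewrite E; simpl; lra.
Qed.

Lemma compatible_A m i j :
  compatible (fun n => stage_A (INR (freq m n)) (swap_index n i) (swap_index n j)).
Proof.
intros n p Hp; destruct (to_stage n p) as [[x y] s] eqn:E.
rewrite (to_stage_S n p x y s E), freq_S, !(swap_index_S n); apply stage_A_match.
generalize (height_to_stage n p); rewrite E; simpl; lra.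
Qed.

(** Entries of size 1/12 change the quadratic form by at most |xi|^2 / 4, while the diagonal part is
    at least |xi|^2 / 2. *)
Lemma stage_elliptic k p (xi : nat -> R) : 56000 <= k ->
  (forall i j, (i < 3)%nat -> (j < 3)%nat -> Rabs (stage_pert k i j p) <= 1 / 12) ->
  / 10 ^ 10 * sum3 (fun i => xi i ^ 2)
    <= sum3 (fun i => sum3 (fun j => xi i * stage_A k i j p * xi j))
    <= 10 ^ 10 * sum3 (fun i => xi i ^ 2).
Proof.
intros Hk Hp.
assert (Hterm : forall i j, (i < 3)%nat -> (j < 3)%nat ->
  Rabs (xi i * stage_pert k i j p * xi j) <= / 24 * (xi i ^ 2 + xi j ^ 2)).
(* The sum of (1/12 - e)(u - v)^2 and (1/12 + e)(u + v)^2 is (u^2 + v^2)/6 + 4euv; exchanging the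
   signs gives the other bound. *)
{ intros i j Hi Hj; specialize (Hp i j Hi Hj); apply Rabs_le_between in Hp.
  set (e := stage_pert k i j p) in *; set (u := xi i); set (v := xi j).
  assert (0 <= (u - v) ^ 2) by apply pow2_ge_0; assert (0 <= (u + v) ^ 2) by apply pow2_ge_0.
  apply Rabs_le; split.
  - assert (0 <= (1 / 12 - e) * (u - v) ^ 2) by (apply Rmult_le_pos; lra).
    assert (0 <= (1 / 12 + e) * (u + v) ^ 2) by (apply Rmult_le_pos; lra). lra.
  - assert (0 <= (1 / 12 - e) * (u + v) ^ 2) by (apply Rmult_le_pos; lra).
    assert (0 <= (1 / 12 + e) * (u - v) ^ 2) by (apply Rmult_le_pos; lra). lra. }
assert (Ha := coefa_bounds k (coord p 2) Hk).
assert (E : sum3 (fun i => sum3 (fun j => xi i * stage_A k i j p * xi j)) =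
  (coefa k (coord p 2) * xi 0%nat ^ 2 + xi 1%nat ^ 2 + xi 2%nat ^ 2)
  + sum3 (fun i => sum3 (fun j => xi i * stage_pert k i j p * xi j))).
{ unfold sum3, stage_A, stage_diag, sep, ones; destruct p as [[x y] t]; simpl; ring. }
rewrite E; clear E.
assert (B : Rabs (sum3 (fun i => sum3 (fun j => xi i * stage_pert k i j p * xi j)))
  <= 1 / 4 * sum3 (fun i => xi i ^ 2)).
{ unfold sum3.
  assert (H00 := Hterm 0%nat 0%nat ltac:(lia) ltac:(lia)); assert (H01 := Hterm 0%nat 1%nat ltac:(lia) ltac:(lia));
  assert (H02 := Hterm 0%nat 2%nat ltac:(lia) ltac:(lia)); assert (H10 := Hterm 1%nat 0%nat ltac:(lia) ltac:(lia));
  assert (H11 := Hterm 1%nat 1%nat ltac:(lia) ltac:(lia)); assert (H12 := Hterm 1%nat 2%nat ltac:(lia) ltac:(lia));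
  assert (H20 := Hterm 2%nat 0%nat ltac:(lia) ltac:(lia)); assert (H21 := Hterm 2%nat 1%nat ltac:(lia) ltac:(lia));
  assert (H22 := Hterm 2%nat 2%nat ltac:(lia) ltac:(lia)).
  apply Rabs_le_between in H00, H01, H02, H10, H11, H12, H20, H21, H22.
  apply Rabs_le; split; lra. }
apply Rabs_le_between in B; unfold sum3 in *.
assert (S0 := pow2_ge_0 (xi 0%nat)); assert (S1 := pow2_ge_0 (xi 1%nat)); assert (S2 := pow2_ge_0 (xi 2%nat)).
assert (1 / 2 * xi 0%nat ^ 2 <= coefa k (coord p 2) * xi 0%nat ^ 2 <= 10 ^ 9 * xi 0%nat ^ 2)
  by (split; apply Rmult_le_compat_r; lra).
split; lra.
Qed.

(** Exchanging x and y permutes the gradient, the rows and the columns alike, so the divergence is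
    that of the strip solution. *)
Lemma global_div m : 1 <= INR m -> forall p, Omega p ->
  div_A_grad (global_A m) (global_u m) p = 0.
Proof.
intros Hm p Hp; set (n := stage_index p); set (k := INR (freq m n)).
assert (Hk : 1 <= k).
{ unfold k; rewrite <- freq_ge; assert (1 <= 2 ^ n) by (apply pow_R1_Rle; lra); nra. }
assert (L := fun i j => glue_eq_loc _ p (compatible_A m i j) Hp).
rewrite <- (stage_div k (to_stage n p) Hk (proj1 (proj2 (locally_singleton _ _ (L 0%nat 0%nat))))).
unfold div_A_grad.
etransitivity; [|apply (sum3_swap n (fun i => partial i (fun q => sum3 (fun j =>
    stage_A k i j q * partial j (stage_u k) q)) (to_stage n p)))].
assert (E : forall i, (i < 3)%nat ->
  partial i (fun q => sum3 (fun j => global_A m i j q * partial j (global_u m) q)) p =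
  partial (swap_index n i) (fun q => sum3 (fun j =>
    stage_A k (swap_index n i) j q * partial j (stage_u k) q)) (to_stage n p)).
{ intros i Hi; rewrite <- partial_to_stage; apply partial_ext_loc.
  generalize (filter_and _ _ (filter_and _ _ (L i 0%nat) (filter_and _ _ (L i 1%nat) (L i 2%nat)))
    (filter_and _ _ (partial_glue_loc _ p 0 (compatible_u m) Hp)
    (filter_and _ _ (partial_glue_loc _ p 1 (compatible_u m) Hp)
      (partial_glue_loc _ p 2 (compatible_u m) Hp)))).
  apply filter_imp; intros q [[[_ [_ A0]] [[_ [_ A1]] [_ [_ A2]]]] [U0 [U1 U2]]].
  etransitivity; [|apply (sum3_swap n (fun j => stage_A k (swap_index n i) j (to_stage n q)
    * partial j (stage_u k) (to_stage n q)))].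
  unfold sum3, global_A, global_u; rewrite A0, A1, A2, U0, U1, U2; reflexivity. }
apply (f_equal2 Rplus); [apply (f_equal2 Rplus)|]; apply E; lia.
Qed.

(** Every threshold is met by all k >= m, hence by all frequencies m 2^n at once and with the same
    [M]. *)
Lemma exists_frequency :
  exists m M, 56000 <= INR m /\
    (forall k p, INR m <= k -> -1 < coord p 2 < 4 ->
      (forall i j, (i < 3)%nat -> (j < 3)%nat ->
        C1_at (stage_A k i j) M p /\ Rabs (stage_pert k i j p) <= 1 / 12) /\
      C1_at (stage_u k) (1 * exp (- (1 * k))) p /\
      forall i, (i < 3)%nat -> C1_at (stage_du i k) (1 * exp (- (1 * k))) p).
Proof.
assert (E1 : eventually_ge (fun k => forall i, (i < 3)%nat -> forall j, (j < 3)%nat ->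
  forall p, -1 < coord p 2 < 4 -> C1_at (stage_pert k i j) (1 / 12 * exp (- (0 * k))) p)).
{ apply (eventually_ge_forall3 (fun i k => forall j, (j < 3)%nat ->
    forall p, -1 < coord p 2 < 4 -> C1_at (stage_pert k i j) (1 / 12 * exp (- (0 * k))) p)).
  intros i; apply (eventually_ge_forall3 (fun j k =>
    forall p, -1 < coord p 2 < 4 -> C1_at (stage_pert k i j) (1 / 12 * exp (- (0 * k))) p)).
  intros j; apply (C1_field_small 0 (fun k => stage_pert k i j)); [lra|].
  rewrite Rplus_0_l; apply C1_field_pert. }
assert (E2 := C1_field_small 1 stage_u 1 Rlt_0_1 C1_field_u).
assert (E3 := eventually_ge_forall3 _ (fun i => C1_field_small 1 (stage_du i) 1 Rlt_0_1 (C1_field_du i))).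
destruct (eventually_ge_and _ _ E1 (eventually_ge_and _ _ E2 E3)) as [K HK].
destruct C1_at_stage_diag as [M HM].
destruct (INR_unbounded (Rmax K 56000)) as [m Hm].
assert (H1 := Rmax_l K 56000); assert (H2 := Rmax_r K 56000).
exists m, (M + 1 / 12); split; [lra|]; intros k p Hk Hp.
destruct (HK k ltac:(lra)) as [P1 [P2 P3]].
split; [|split; auto]; intros i j Hi Hj.
assert (P : forall q, -1 < coord q 2 < 4 -> C1_at (stage_pert k i j) (1 / 12) q).
{ intros q Hq; generalize (P1 i Hi j Hj q Hq); now rewrite Rmult_0_l, Ropp_0, exp_0, Rmult_1_r. }
split; [|apply P; auto].
apply C1_at_plus; generalize (locally_height p (-1) 4 Hp); apply filter_imp; auto.
intros q Hq; apply HM; auto; lra.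
Qed.

(** From T/8 < (n + 1)/2 and e <= 3 < 4 one gets e^(T/8) <= 2^(n+1). The prefactor 1/2 is weakened
    to 1/8 so that one constant c serves in both places. *)
Lemma exp_freq_decay (n : nat) T t : T <= t -> t < 4 * INR n + 4 ->
  / 8 * exp (/ 8 * T) <= 2 ^ n.
Proof.
intros HT Ht.
assert (E : exp (/ 8 * T) <= 2 ^ S n).
{ apply Rle_trans with (exp (INR (S n) * / 2)).
  - apply Rlt_le, exp_increasing; rewrite S_INR; lra.
  - replace (exp (INR (S n) * / 2)) with (exp (/ 2) ^ S n).
    + apply pow_incr; split; [apply Rlt_le, exp_pos|].
      assert (H : exp (/ 2) * exp (/ 2) <= 3).
      { rewrite <- exp_plus; replace (/ 2 + / 2) with 1 by lra; apply exp_le_3. }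
      assert (0 < exp (/ 2)) by apply exp_pos; nra.
    + rewrite <- Rpower_pow by apply exp_pos; unfold Rpower; now rewrite ln_exp. }
assert (0 < 2 ^ n) by (apply pow_lt; lra); simpl in E; lra.
Qed.

Theorem theorem1p1 :
  exists (A : nat -> nat -> pt -> R) (u : pt -> R),
    (forall i j, (i < 3)%nat -> (j < 3)%nat ->
       periodic_xy (A i j) /\ unif_C1 (A i j)) /\
    unif_elliptic A /\
    periodic_xy u /\ unif_C2 u /\
    (exists p, Omega p /\ u p <> 0) /\
    (forall p, Omega p -> div_A_grad A u p = 0) /\
    (exists c C, 0 < c /\ 0 < C /\ exists T0, forall T, T0 <= T ->
       forall p, Omega p -> T <= coord p 2 ->
         Rabs (u p) <= C * exp (- c * exp (c * T))).
Proof.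
destruct exists_frequency as [m [M [Hm H]]].
assert (Hf : forall n, INR m * 1 <= INR (freq m n)).
{ intros n; rewrite <- freq_ge; apply Rmult_le_compat_l; [lra|apply pow_R1_Rle; lra]. }
assert (Hs : forall p, Omega p -> -1 < coord (to_stage (stage_index p) p) 2 < 4).
{ intros p Hp; rewrite height_to_stage; generalize (stage_index_spec p Hp); lra. }
assert (Hd : forall F p, C1_at F (1 * exp (- (1 * INR (freq m (stage_index p))))) p -> C1_at F 1 p).
{ intros F p; apply C1_at_le; rewrite !Rmult_1_l, <- exp_0.
  apply Rlt_le, exp_increasing; generalize (Hf (stage_index p)); lra. }
assert (He : forall n, 1 * exp (- (1 * INR (freq m n))) <= 1).
{ intros n; rewrite !Rmult_1_l, <- exp_0.
  apply Rlt_le, exp_increasing; generalize (Hf n); lra. }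
assert (Hu : forall p, Omega p -> C1_at (global_u m) 1 p).
{ intros p Hp; apply C1_at_glue; auto using compatible_u.
  intros n q Hq; apply C1_at_le with (1 := He n).
  apply H; auto; generalize (Hf n); lra. }
exists (global_A m), (global_u m); split; [|split; [|split; [|split; [|split; [|split]]]]].
- intros i j Hi Hj; split.
  + apply periodic_glue; intros n; apply periodic_stage_A.
  + apply unif_C1_C1_at with M; intros p Hp; apply C1_at_glue; auto using compatible_A.
    intros n q Hq; apply H; auto using swap_index_lt; generalize (Hf n); lra.
- exists (10 ^ 10); split; [lra|]; intros p Hp xi.
  set (n := stage_index p).
  assert (Hk : INR m <= INR (freq m n)) by (generalize (Hf n); lra).
  (* The vector is permuted like the coordinates, which preserves its norm. *)
  destruct (stage_elliptic (INR (freq m n)) (to_stage n p) (fun i => xi (swap_index n i))) as [L U].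
  + lra.
  + intros i j Hi Hj; apply (H _ _ Hk (Hs p Hp)); auto.
  + rewrite (sum3_swap n (fun i => xi i ^ 2)) in L, U.
    assert (E : sum3 (fun i => sum3 (fun j => xi i * global_A m i j p * xi j)) =
      sum3 (fun i => sum3 (fun j => xi (swap_index n i) *
        stage_A (INR (freq m n)) i j (to_stage n p) * xi (swap_index n j)))).
    { unfold sum3, global_A, glue, swap_index; fold n; destruct (Nat.even n); ring. }
    now rewrite E.
- apply periodic_glue; intros n; apply periodic_stage_u.
- split; [now apply unif_C1_C1_at with 1|]; intros i Hi; apply unif_C1_C1_at with 1.
  intros p Hp; set (n := stage_index p).
  (* Near [p] the first derivatives are the explicit fields [stage_du], so their C^1 bounds control
     the second derivatives. *)
  apply C1_at_ext_loc with (fun q => stage_du (swap_index n i) (INR (freq m n)) (to_stage n q)).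
  + generalize (filter_and _ _ (partial_glue_loc _ p i (compatible_u m) Hp)
      (glue_eq_loc _ p (compatible_u m) Hp)); apply filter_imp; intros q [E [_ [Hq _]]].
    unfold global_u; rewrite E; apply partial_stage_u; auto.
    fold n; generalize (Hf n); lra.
  + apply C1_at_to_stage, C1_at_le with (1 := He n).
    apply H; auto using swap_index_lt; [generalize (Hf n); lra|now apply Hs].
(* At s = 1 both amplitudes are positive, and at x = y = 0 both cosines equal 1. *)
- exists (0, 0, 1); assert (Hp : Omega (0, 0, 1)) by (unfold Omega; simpl; lra).
  split; auto; unfold global_u, glue.
  rewrite (stage_index_eq _ 0 Hp) by (simpl; lra).
  unfold to_stage, stage_u, sep, fallP, riseQ, damp, ones, cosx, cosy; simpl.
  rewrite !Rmult_0_r, Rminus_0_r, !cos_0, (step_right 1), (step_left (1 - 2)) by lra.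
  apply Rgt_not_eq; apply Rplus_lt_0_compat; repeat apply Rmult_lt_0_compat; try lra; apply exp_pos.
- apply global_div; lra.
- exists (/ 8), 1; split; [lra|split; [lra|]]; exists 0; intros T _ p Hp HT.
  set (n := stage_index p); assert (Hn := stage_index_spec p Hp); fold n in Hn.
  unfold global_u, glue; fold n.
  assert (Hk : INR m <= INR (freq m n)) by (generalize (Hf n); lra).
  destruct (H _ _ Hk (Hs p Hp)) as [_ [[_ [B _]] _]].
  eapply Rle_trans; [apply B|]; apply Rmult_le_compat_l; [lra|].
  assert (D := exp_freq_decay n T (coord p 2) HT (proj2 Hn)).
  (* The solution is bounded by e^{-k} with k = m 2^n, and k exceeds 2^n, which is at least e^(T/8)
     / 8. *)
  assert (2 ^ n < INR (freq m n)).
  { rewrite <- freq_ge; assert (1 <= 2 ^ n) by (apply pow_R1_Rle; lra); nra. }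
  apply Rlt_le, exp_increasing; lra.
Qed.
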